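(* Let $H$ be a Krull monoid with class group $G$ such that every class of $G$ contains a prime divisor. Then $\daleth^*(H)$ is an interval (a set of consecutive integers, possibly empty or infinite) and $\daleth^*(H) \subset \mathcal R(H)$. Moreover, if $G$ is finite and $\mathsf D(G) = \mathsf D^*(G) \ge 4$, then \[ \mathcal R(H) = \daleth^*(H) \cup \{2\} = \big(2 + \Delta(H)\big) \cup \{2\} = [2, \mathsf c(H)] \,. \] In detail: (1) If $|G|=1$, then $\mathcal R(H)=\emptyset$; if $|G|=2$, then $\mathcal R(H)=\{2\}$; if $G$ is infinite, then $\mathcal R(H) = \mathbb N_{\ge 2}$. (2) If $\mathsf D(G)=3$ and every nonzero class of $G$ contains precisely one prime divisor, then $\mathcal R(H) = \daleth^*(H) = \{3\}$. (3) If either ($\mathsf D(G)=3$ and there is a nonzero class containing at least two distinct prime divisors) or $\mathsf D(G) \ge 4$, then $\min \mathcal R(H) = 2$ and $\min \daleth^*(H) = 3$.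
   Context: A monoid is a commutative cancellative semigroup with identity, written multiplicatively; $H^\times$ is its unit group, $H_{\mathrm{red}} = H/H^\times$, and $\mathcal A(H)$ its set of atoms. For $a \in H$, a factorization of $a$ is an element $z = u_1\cdots u_k$ of the free abelian monoid $\mathsf Z(H)$ on $\mathcal A(H_{\mathrm{red}})$ whose product is $aH^\times$; $\mathsf Z(a)$ is the set of factorizations, $|z|=k$ is the length, and $\mathsf L(a)=\{|z| : z \in \mathsf Z(a)\}$. For a finite set $L=\{a_1<\dots<a_k\}\subset\mathbb Z$, $\Delta(L)=\{a_{i+1}-a_i\}$; $\Delta(H)=\bigcup_{a\in H}\Delta(\mathsf L(a))$, and $2+\Delta(H)=\{2+d : d \in \Delta(H)\}$. $[a,b]$ denotes $\{c\in\mathbb Z : a\le c\le b\}$. Define $\daleth^*(H) = \{\min(\mathsf L(uv)\setminus\{2\}) : u,v \in \mathcal A(H),\ |\mathsf L(uv)|>1\}$. For factorizations $z,z'$, write $z = u_1\cdots u_k v_1\cdots v_\ell$, $z'=u_1\cdots u_k w_1\cdots w_m$ with $\{v_i\}\cap\{w_j\}=\emptyset$; the distance is $\mathsf d(z,z')=\max\{\ell,m\}$. For $N\in\mathbb N_0$, an $N$-chain from $z$ to $z'$ in $\mathsf Z(a)$ is a sequence $z=z_0,z_1,\dots,z_n=z'$ in $\mathsf Z(a)$ with $\mathsf d(z_{i-1},z_i)\le N$ for all $i$. The catenary degree $\mathsf c(a)$ is the least $N\in\mathbb N_0\cup\{\infty\}$ such that any two factorizations of $a$ are connected by an $N$-chain,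 and $\mathsf c(H)=\sup_{a\in H}\mathsf c(a)$. $\mathcal R(H)$ is the set of all $d\in\mathbb N_{\ge 2}$ such that there exist $a\in H$ and distinct $z,z'\in\mathsf Z(a)$ with $\mathsf d(z,z')=d$ that cannot be connected by a $(d-1)$-chain. A monoid $H$ is a Krull monoid if there is a divisor theory $H_{\mathrm{red}}\hookrightarrow F=\mathcal F(P)$: $F$ is free abelian with basis $P$, the embedding is a divisor homomorphism ($a \mid b$ in $F$ implies $a\mid b$ in $H_{\mathrm{red}}$), and every element of $F$ is the gcd of finitely many elements of $H_{\mathrm{red}}$. The elements of $P$ are the prime divisors; the class group is $G=\mathsf q(F)/\mathsf q(H_{\mathrm{red}})$ (quotient groups), and the class of $p\in P$ is $p\,\mathsf q(H_{\mathrm{red}})$. For a finite abelian group $G$, the Davenport constant $\mathsf D(G)$ is the maximal length of a minimal zero-sum sequence over $G$ (a nonempty sequence of elements of $G$ summing to $0$ with no proper nonempty zero-sum subsequence). If $G\cong C_{n_1}\oplus\dots\oplus C_{n_r}$ with $1<n_1\mid\dots\mid n_r$, then $\mathsf D^*(G)=1+\sum_{i=1}^r(n_i-1)$. *)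

(* Defs.v *)
From HB Require Import structures.
From mathcomp Require Import all_boot all_order all_algebra.
From Stdlib Require Sorting.Permutation.

Set Implicit Arguments.
Unset Strict Implicit.
Unset Printing Implicit Defensive.

Import GRing.Theory.
Local Open Scope ring_scope.

Notation Perm := Permutation.Permutation.

Record cmonoid := CMonoid {
  carrier :> Type;
  mmul : carrier -> carrier -> carrier;
  mone : carrier;
  mmulC : forall a b, mmul a b = mmul b a;
  mmulA : forall a b c, mmul a (mmul b c) = mmul (mmul a b) c;
  mmul1 : forall a, mmul mone a = a;
  mmulK : forall a b c, mmul a b = mmul a c -> b = c
}.

Section MonoidDefs.
Variable H : cmonoid.

Definition munit (u : H) : Prop := exists v, mmul u v = mone H.
Definition mdvd (a b : H) : Prop := exists c, b = mmul a c.
Definition massoc (a b : H) : Prop := exists u, munit u /\ b = mmul a u.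
(* atoms of H (their classes are exactly the atoms of H_red) *)
Definition atom (a : H) : Prop :=
  ~ munit a /\ forall b c, a = mmul b c -> munit b \/ munit c.

Definition mprod (z : list H) : H := foldr (@mmul H) (mone H) z.

(* A factorization is an element of the free abelian monoid on A(H_red);
   we represent it by a list of atoms of H, two lists representing the same
   factorization iff they agree up to order and associates. *)
Definition fact_eq (z z' : list H) : Prop :=
  exists z'', Perm z z'' /\ List.Forall2 massoc z'' z'.

Definition factorization (a : H) (z : list H) : Prop :=
  List.Forall atom z /\ massoc (mprod z) a.

Definition in_L (a : H) (l : nat) : Prop :=
  exists z, factorization a z /\ size z = l.

Definition fdist (z z' : list H) (d : nat) : Prop :=
  exists c c' v w, [/\ Perm z (c ++ v), Perm z' (c' ++ w),
    List.Forall2 massoc c c',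
    (forall x y, List.In x v -> List.In y w -> ~ massoc x y) &
    d = maxn (size v) (size w)].

Definition fdist_le (z z' : list H) (N : nat) : Prop :=
  exists d, fdist z z' d /\ (d <= N)%N.

Inductive chain (a : H) (N : nat) : list H -> list H -> Prop :=
| chain_nil z : factorization a z -> chain a N z z
| chain_cons z y z' : factorization a z -> fdist_le z y N ->
    chain a N y z' -> chain a N z z'.

Definition cat_elt_le (a : H) (N : nat) : Prop :=
  forall z z', factorization a z -> factorization a z' -> chain a N z z'.

Definition cat_le (N : nat) : Prop := forall a, cat_elt_le a N.

(* d <= c(H), with c(H) in N_0 \cup {infty} the least N with c(H) <= N *)
Definition le_cat (d : nat) : Prop := forall N, cat_le N -> (d <= N)%N.

Definition in_R (d : nat) : Prop :=
  (2 <= d)%N /\ exists a z z', [/\ factorization a z, factorization a z',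
     ~ fact_eq z z', fdist z z' d & ~ chain a d.-1 z z'].

Definition in_Delta (delta : nat) : Prop :=
  exists a l, [/\ in_L a l, in_L a (l + delta), (0 < delta)%N &
     forall k, (l < k < l + delta)%N -> ~ in_L a k].

Definition in_daleth (m : nat) : Prop :=
  exists u v, atom u /\ atom v /\ [/\
    (exists l1 l2, [/\ in_L (mmul u v) l1, in_L (mmul u v) l2 & l1 <> l2]),
    in_L (mmul u v) m, m <> 2%N &
    forall l, in_L (mmul u v) l -> l <> 2%N -> (m <= l)%N].

End MonoidDefs.

(* The free abelian monoid F(P) is represented by lists over P, up to  *)
(* permutation.                                                        *)
Section Krull.
Variable P : Type.

Definition Fdiv (s t : list P) : Prop := exists r, Perm (s ++ r) t.

Definition F_is_gcd (s : list P) (xs : list (list P)) : Prop :=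
  List.Forall (Fdiv s) xs /\
  forall t, List.Forall (Fdiv t) xs -> Fdiv t s.

(* phi : H -> F(P) induces a divisor theory H_red -> F(P) *)
Definition divisor_theory (H : cmonoid) (phi : H -> list P) : Prop :=
  [/\ Perm (phi (mone H)) [::],
      (forall a b, Perm (phi (mmul a b)) (phi a ++ phi b)),
      (forall a b, Perm (phi a) (phi b) -> massoc a b),
      (forall a b, Fdiv (phi a) (phi b) -> mdvd a b) &
      (forall s, exists l : list H, F_is_gcd s (map phi l))].

Definition Fdeg (G : zmodType) (cls : P -> G) (s : list P) : G :=
  \sum_(p <- s) cls p.

(* (G, cls) is the class group q(F)/q(H_red) together with the class map
   p |-> p q(H_red): the homomorphism q(F) -> G extending cls is
   surjective with kernel q(H_red). *)
Definition class_group (H : cmonoid) (phi : H -> list P)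
    (G : zmodType) (cls : P -> G) : Prop :=
  (forall s t, Fdeg cls s = Fdeg cls t <->
      exists a b : H, Perm (s ++ phi b) (t ++ phi a)) /\
  (forall g, exists s t, g = Fdeg cls s - Fdeg cls t).

Definition Krull_with_class_group (H : cmonoid) (phi : H -> list P)
    (G : zmodType) (cls : P -> G) : Prop :=
  divisor_theory phi /\ class_group phi cls.

End Krull.

Section Groups.
Variable G : zmodType.

Definition grp_finite : Prop := exists s : seq G, forall g, g \in s.
Definition grp_card (n : nat) : Prop :=
  exists s : seq G, [/\ uniq s, size s = n & forall g, g \in s].

Definition min_zero_sum (s : seq G) : Prop :=
  [/\ s <> [::], \sum_(g <- s) g = 0 &
      forall m : bitseq, mask m s <> [::] -> \sum_(g <- mask m s) g = 0 ->
        size (mask m s) = size s].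

Definition Davenport_eq (n : nat) : Prop :=
  (exists s, min_zero_sum s /\ size s = n) /\
  (forall s, min_zero_sum s -> (size s <= n)%N).

(* D(G) >= n  (D(G) = sup of lengths of minimal zero-sum sequences,
   possibly infinite) *)
Definition Davenport_ge (n : nat) : Prop :=
  exists s, min_zero_sum s /\ (n <= size s)%N.

(* D^*(G) = n : G = C_{n_1} + ... + C_{n_r}, 1 < n_1 | ... | n_r,
   n = 1 + sum (n_i - 1).  The decomposition is given by elements e_i
   with n_i e_i = 0 such that (k_i)_{0<=k_i<n_i} |-> sum k_i e_i is a
   bijection onto G. *)
Definition Dstar_eq (n : nat) : Prop :=
  exists (ns : seq nat) (es : seq G),
    [/\ size es = size ns, all (fun k => 1 < k)%N ns, sorted dvdn ns &
        n = (1 + \sum_(k <- ns) (k - 1))%N] /\ [/\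
        (forall i, (i < size ns)%N -> (nth 0 es i) *+ (nth 0%N ns i) = 0) &
        (forall g, exists! ks : seq nat,
            [/\ size ks = size ns,
                (forall i, (i < size ns)%N -> nth 0%N ks i < nth 0%N ns i)%N &
                g = \sum_(i < size ns) (nth 0 es i) *+ (nth 0%N ks i)])].

End Groups.

(* Main.v *)
Require Import Defs.
From HB Require Import structures.
From mathcomp Require Import all_boot all_order all_algebra.
From mathcomp Require Import zify boolp.
From Stdlib Require Permutation.

(* A divisor theory identifies H_red with the zero-sum lists over P, so that
   atoms become minimal zero-sum lists.

   daleth^* is closed downwards to 3: let U V = W_1 ... W_m with m >= 4 minimal
   nontrivial. Replacing two terms of U by one prime of the sum of their classes
   gives an atom U' and lowers nontrivial lengths by at most 1. Merging inside
   some W_i keeps the length m, so by induction on |U| + |V| all W_i may be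
   assumed to be pairs x_i y_i; then merging x_1 and x_2 yields the length m - 1.

   Catenary degree: if every minimal zero-sum list has length at most D, then c(H) is
   at most the maximum of 2, D/2 + 1 and sup daleth^*. By induction on |a|,
   factorizations of a sharing an atom are connected; a factorization of length 2
   can be replaced by one of length in daleth^*, and for a long z against
   V_1 V_2 V_3 ... the product V_1 V_2 minus one atom of z still has at least D
   terms, hence contains a zero-sum list dividing both sides.

   Elements of daleth^*: for independent e_i of orders n_i, take
   U = e_0 prod e_i^(n_i/2) and V = -U; every atom dividing U V has length 2 or |U|,
   so |U| = 1 + sum n_i/2 belongs to daleth^*. When D = D^* this is at least
   D/2 + 1. In an infinite group, a greedy choice of elements that are
   independent modulo 2 for coefficients in [-2, 2] gives arbitrarily large values. *)

Set Implicit Arguments.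
Unset Strict Implicit.
Unset Printing Implicit Defensive.

Ltac perm_count :=
  let a := fresh "a" in
  apply/permP => a;
  repeat match goal with H : is_true (perm_eq _ _) |- _ =>
    first [move/permP/(_ a): H | clear H] end;
  rewrite ?flatten_cat /= ?count_cat /= ?count_cat /=;
  lia.

(** * Zero-sum lists *)

Section ZeroSum.

Import GRing.Theory.
Local Open Scope ring_scope.

Variables (P : eqType) (G : zmodType) (cls : P -> G).
Implicit Types (s t u v w : seq P) (ws : seq (seq P)).

Local Notation sg := (Fdeg cls).

Lemma sg_cons x s : sg (x :: s) = cls x + sg s.
Proof. by rewrite /Fdeg big_cons. Qed.

Lemma sg_nil : sg [::] = 0.
Proof. by rewrite /Fdeg big_nil. Qed.

Lemma sg_cat s t : sg (s ++ t) = sg s + sg t.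
Proof. by rewrite /Fdeg big_cat. Qed.

Lemma sg_perm s t : perm_eq s t -> sg s = sg t.
Proof. by move=> st; apply: perm_big. Qed.

Lemma perm_nil_r s : perm_eq s [::] -> s = [::].
Proof. by move/perm_nilP. Qed.

Lemma perm_split x s : x \in s -> exists t, perm_eq s (x :: t).
Proof. by move=> xs; exists (rem x s); apply: perm_to_rem. Qed.

(** The Riesz refinement property of the free monoid [F(P)]; the comparisons of two factorizations
    below rest on it. *)
Lemma perm_cat_split s t u v : perm_eq (s ++ t) (u ++ v) ->
  exists s1 s2 t1 t2, [/\ perm_eq s (s1 ++ s2), perm_eq t (t1 ++ t2),
    perm_eq u (s1 ++ t1) & perm_eq v (s2 ++ t2)].
Proof.
elim: u s t => [|x u IH] s t /= e.
  by exists [::], s, [::], t; split=> //; rewrite perm_sym.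
have: x \in s ++ t by rewrite (perm_mem e) mem_head.
rewrite mem_cat => /orP[] /perm_split[r er].
- have /IH[s1 [s2 [t1 [t2 [a b c d]]]]]: perm_eq (r ++ t) (u ++ v).
    by rewrite -(perm_cons x); perm_count.
  by exists (x :: s1), s2, t1, t2; split=> //; perm_count.
- have /IH[s1 [s2 [t1 [t2 [a b c d]]]]]: perm_eq (s ++ r) (u ++ v).
    by rewrite -(perm_cons x); perm_count.
  by exists s1, s2, (x :: t1), t2; split=> //; perm_count.
Qed.

(** The atoms of the monoid of zero-sum lists over [P]. Splitting up to permutation, rather than by
    masks, makes the notion visibly invariant under reordering. *)
Definition minzs s := [/\ s <> [::], sg s = 0 &
  forall s1 s2, perm_eq s (s1 ++ s2) -> sg s1 = 0 -> s1 = [::] \/ s2 = [::]].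

Lemma minzs_perm s t : perm_eq s t -> minzs s -> minzs t.
Proof.
move=> st [s0 zs ms]; split.
- by move=> t0; apply: s0; apply/perm_nilP; rewrite -t0.
- by rewrite -(sg_perm st).
- by move=> s1 s2 e; apply: ms; exact: perm_trans st e.
Qed.

Lemma minzs_sub s t r : minzs s -> perm_eq s (t ++ r) -> sg t = 0 ->
  t <> [::] -> r = [::] /\ perm_eq s t.
Proof.
move=> [_ _ ms] e zt t0; case: (ms _ _ e zt) => // r0; split=> //.
by move: e; rewrite r0 cats0.
Qed.

Definition decomp s ws := (forall w, w \in ws -> minzs w) /\ perm_eq s (flatten ws).

Lemma decomp_nil : decomp [::] [::].
Proof. by split. Qed.

Lemma decomp_perm s t ws : perm_eq s t -> decomp s ws -> decomp t ws.
Proof. by move=> st [a b]; split=> //; perm_count. Qed.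

Lemma decomp1 s : minzs s -> decomp s [:: s].
Proof. by move=> m; split=> [w|]; rewrite /= ?inE ?cats0 // => /eqP->. Qed.

Lemma decomp_cat s t ws vs :
  decomp s ws -> decomp t vs -> decomp (s ++ t) (ws ++ vs).
Proof.
move=> [a b] [c d]; split; last by rewrite flatten_cat; perm_count.
by move=> w; rewrite mem_cat => /orP[/a|/c].
Qed.

Lemma decomp_cons w s ws : minzs w -> decomp s ws -> decomp (w ++ s) (w :: ws).
Proof. by move=> /decomp1 m d; exact: decomp_cat m d. Qed.

Lemma decomp_zs s ws : decomp s ws -> sg s = 0.
Proof.
move=> [a /sg_perm->] {s}; elim: ws a => [|w ws IH] a; first by rewrite sg_nil.
rewrite /= sg_cat IH => [|v vws]; last by apply: a; rewrite inE vws orbT.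
by case: (a w (mem_head _ _)) => _ -> _; rewrite addr0.
Qed.

Lemma decomp_self ws : (forall w, w \in ws -> minzs w) -> decomp (flatten ws) ws.
Proof. by []. Qed.

Lemma decomp_rem s ws w : decomp s ws -> w \in ws ->
  [/\ minzs w, perm_eq s (w ++ flatten (rem w ws)),
      decomp (flatten (rem w ws)) (rem w ws) & size ws = (size (rem w ws)).+1].
Proof.
move=> [a b] wws; split; first exact: a.
- apply: perm_trans b _; rewrite -[w ++ _]/(flatten (w :: rem w ws)).
  exact/perm_flatten/perm_to_rem.
- by apply: decomp_self => v /mem_rem/a.
- by rewrite size_rem //; case: ws wws {a b}.
Qed.

Lemma decomp_nilP ws : decomp [::] ws -> ws = [::].
Proof.
case: ws => // w ws [a /perm_size /=]; rewrite size_cat.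
by case: (a w (mem_head _ _)); case: w {a}.
Qed.

Lemma decomp_exists s : sg s = 0 -> exists ws, decomp s ws.
Proof.
have [n] := ubnP (size s); elim: n s => // n IH s ltn zs.
have [->|/eqP s0] := eqVneq s [::]; first by exists [::]; apply: decomp_nil.
have [[s1 [s2 [e z1 s10 s20]]]|nex] := pselect (exists s1 s2,
  [/\ perm_eq s (s1 ++ s2), sg s1 = 0, s1 <> [::] & s2 <> [::]]).
- have z2 : sg s2 = 0 by move: zs; rewrite (sg_perm e) sg_cat z1 add0r.
  have sz := perm_size e; rewrite size_cat in sz.
  have l1 : (0 < size s1)%N by case: (s1) s10.
  have l2 : (0 < size s2)%N by case: (s2) s20.
  have [|ws1 d1] := IH s1 _ z1; first by lia.
  have [|ws2 d2] := IH s2 _ z2; first by lia.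
  exists (ws1 ++ ws2); apply: decomp_perm (decomp_cat d1 d2); by rewrite perm_sym.
- exists [:: s]; apply: decomp1; split=> // s1 s2 e z1.
  have [->|/eqP s10] := eqVneq s1 [::]; first by left.
  have [->|/eqP s20] := eqVneq s2 [::]; first by right.
  by case: nex; exists s1, s2.
Qed.

Definition haslen s k := exists ws, decomp s ws /\ size ws = k.

Lemma haslen_perm s t k : perm_eq s t -> haslen s k -> haslen t k.
Proof. by move=> st [ws [d e]]; exists ws; split=> //; apply: decomp_perm d. Qed.

Lemma haslen_minzs s k : minzs s -> haslen s k -> k = 1%N.
Proof.
move=> ms [[|w ws] [d <-]].
  by case: d ms => _ /perm_nil_r-> [].
have [[w0 zw _] e d' _] := decomp_rem d (mem_head _ _).
rewrite /= eqxx in e d'.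
by have [r0 _] := minzs_sub ms e zw w0; rewrite r0 in d'; rewrite (decomp_nilP d').
Qed.

Lemma haslen1 s : haslen s 1 -> minzs s.
Proof.
move=> [ws [[a e] sz]]; case: ws sz a e => [|w [|w' ws]] //= _ a e.
rewrite cats0 in e.
by apply: minzs_perm (a _ (mem_head _ _)); rewrite perm_sym.
Qed.

Lemma haslen_pair u v : minzs u -> minzs v -> haslen (u ++ v) 2.
Proof.
by move=> mu mv; exists [:: u; v]; split=> //; apply: decomp_cons => //; apply: decomp1.
Qed.

Lemma haslen_pair_ge2 u v k : minzs u -> minzs v -> haslen (u ++ v) k -> (2 <= k)%N.
Proof.
move=> [u0 zu _] [v0 _ _]; case: k => [|[|//]].
  move=> [ws [[_ e] sz]]; case: ws sz e => //= _ /perm_nil_r.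
  by case: (u) u0.
move=> /haslen1 mm; have [v0' _] := minzs_sub mm (perm_refl _) zu u0.
by case: v0.
Qed.

Lemma minzs2 x y : cls x <> 0 -> cls x + cls y = 0 -> minzs [:: x; y].
Proof.
move=> x0 xy; have y0 : cls y <> 0 by move=> y0; apply: x0; rewrite -xy y0 addr0.
split=> //; first by rewrite !sg_cons sg_nil addr0.
case=> [|z [|z' s1]] s2 e; first by left.
  have: z \in [:: x; y] by rewrite (perm_mem e) mem_head.
  by rewrite sg_cons sg_nil addr0 !inE => /orP[]/eqP->.
by move: (perm_size e); rewrite /= size_cat; case: s2 {e}; [right | move=> /= *; lia].
Qed.

(** Any splitting of three terms has a part with at most one term, and a single term of nonzero
    class is not zero-sum. *)
Lemma minzs3 x y z : cls x <> 0 -> cls y <> 0 -> cls z <> 0 ->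
  cls x + cls y + cls z = 0 -> minzs [:: x; y; z].
Proof.
move=> x0 y0 z0 xyz.
have zs : sg [:: x; y; z] = 0 by rewrite !sg_cons sg_nil addr0 addrA.
have nz a : a \in [:: x; y; z] -> cls a <> 0.
  by rewrite !inE => /or3P[]/eqP->.
split=> // s1 s2 e zs1.
have zs2 : sg s2 = 0 by move: zs; rewrite (sg_perm e) sg_cat zs1 add0r.
have m a : a \in s1 ++ s2 -> cls a <> 0 by rewrite -(perm_mem e); apply: nz.
have := perm_size e; rewrite size_cat /=.
case: s1 {e} zs1 m => [|a [|b s1]] zs1 m; first by left.
  by case: (m a (mem_head _ _)); move: zs1; rewrite sg_cons sg_nil addr0.
case: s2 zs2 m => [|c [|d s2]] zs2 m /=; first by right.
  have: c \in [:: a, b & s1] ++ [:: c] by rewrite mem_cat mem_head orbT.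
  by move/m; move: zs2; rewrite sg_cons sg_nil addr0.
by move=> *; lia.
Qed.

(** * Merging two terms of a list *)

Section Merge.

Variables (p q r : P).
Hypothesis r_pq : cls r = cls p + cls q.

(** Putting [p, q] back in place of [r] preserves sums, so a splitting of the merged list comes from
    a splitting of the original one. *)
Lemma minzs_merge s : minzs [:: p, q & s] -> minzs (r :: s).
Proof.
move=> m; have [_ zs ms] := m.
have zr : sg (r :: s) = 0 by rewrite sg_cons r_pq -zs !sg_cons addrA.
split=> // s1 s2 e zs1.
have: r \in s1 ++ s2 by rewrite -(perm_mem e) mem_head.
rewrite mem_cat => /orP[]/perm_split[t et].
- have [|||] := ms [:: p, q & t] s2.
  + have : perm_eq s (t ++ s2) by rewrite -(perm_cons r); perm_count.
    by move=> ?; perm_count.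
  + by rewrite !sg_cons addrA -r_pq -sg_cons -(sg_perm et).
  + by [].
  + by right.
- have [|||] := ms s1 [:: p, q & t] => //.
  + have : perm_eq s (s1 ++ t) by rewrite -(perm_cons r); perm_count.
    by move=> ?; perm_count.
  + by left.
Qed.

(* The atom containing [r] becomes, once [r] is replaced by [p, q], a product
   of at most two atoms, since each of them contains [p] or [q]. *)
Lemma haslen_unmerge s k : haslen (r :: s) k ->
  haslen [:: p, q & s] k \/ haslen [:: p, q & s] k.+1.
Proof.
move=> [ws [d <-]].
have /flattenP[w wws rw] : r \in flatten ws by rewrite -(perm_mem d.2) mem_head.
have [mw e d' ->] := decomp_rem d wws.
have [t et] := perm_split rw.
have es : perm_eq s (t ++ flatten (rem w ws)) by rewrite -(perm_cons r); perm_count.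
have [zw mmw] : sg w = 0 /\ minzs (r :: t) by split; [case: mw | apply: minzs_perm mw].
have zt : sg [:: p, q & t] = 0 by rewrite !sg_cons addrA -r_pq -sg_cons -(sg_perm et).
have [vs dv] := decomp_exists zt.
suff sv : size vs = 1%N \/ size vs = 2%N.
  have dd : decomp [:: p, q & s] (vs ++ rem w ws).
    by apply: decomp_perm (decomp_cat dv d'); perm_count.
  by case: sv => sv; [left | right]; exists (vs ++ rem w ws); rewrite size_cat sv.
have /flattenP[v1 v1vs pv1] : p \in flatten vs by rewrite -(perm_mem dv.2) mem_head.
have [_ e1 d1 ->] := decomp_rem dv v1vs.
have [t1 et1] := perm_split pv1.
have e2 : perm_eq (q :: t) (t1 ++ flatten (rem v1 vs)) by rewrite -(perm_cons p); perm_count.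
have: q \in t1 ++ flatten (rem v1 vs) by rewrite -(perm_mem e2) mem_head.
rewrite mem_cat => /orP[/perm_split[t2 et2]|/flattenP[v2 v2vs qv2]].
- left; have e3 : perm_eq t (t2 ++ flatten (rem v1 vs)) by rewrite -(perm_cons q); perm_count.
  (* The atoms other than [v1] avoid both [p] and [q], so their product is a zero-sum part, without
     [r], of the atom [w]; it must be empty. *)
  case: mmw => _ _ /(_ (flatten (rem v1 vs)) (r :: t2)) []; try by [].
  + by perm_count.
  + exact: decomp_zs d1.
  + by move=> n; rewrite n in d1; rewrite (decomp_nilP d1).
- right; have [_ e3 d2 ->] := decomp_rem d1 v2vs.
  have [t2 et2] := perm_split qv2.
  have e4 : perm_eq t (t1 ++ t2 ++ flatten (rem v2 (rem v1 vs))).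
    by rewrite -(perm_cons q); perm_count.
  case: mmw => _ _ /(_ (flatten (rem v2 (rem v1 vs))) (r :: t1 ++ t2)) []; try by [].
  + by perm_count.
  + exact: decomp_zs d2.
  + by move=> n; rewrite n in d2; rewrite (decomp_nilP d2).
Qed.

End Merge.

End ZeroSum.

(** * Lengths of products of two atoms *)

Section Lengths.

Import GRing.Theory.
Local Open Scope ring_scope.

Variables (P : eqType) (G : zmodType) (cls : P -> G).
Implicit Types (s t u v w : seq P) (ws : seq (seq P)).

Local Notation sg := (Fdeg cls).
Local Notation minzs := (minzs cls).
Local Notation decomp := (decomp cls).
Local Notation haslen := (haslen cls).

Definition lb_nontrivial_len u v m :=
  forall k, haslen (u ++ v) k -> k <> 2%N -> (m <= k)%N.

(** The counterpart of [in_daleth] for lists over [P]. A product of two atoms has no length below 2,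
    so [2 < m] expresses that [m] differs from 2. *)
Definition zs_daleth m := exists u v,
  [/\ minzs u, minzs v, (2 < m)%N, haslen (u ++ v) m & lb_nontrivial_len u v m].

Lemma lb_nontrivial_lenC u v m : lb_nontrivial_len u v m -> lb_nontrivial_len v u m.
Proof.
by move=> lb k hk; apply: lb; apply: haslen_perm hk; rewrite perm_catC.
Qed.

(** A length k after the merge comes from a length k or k + 1 before it, and k >= 2 keeps k + 1
    different from 2. *)
Lemma lb_merge p q r s v m : cls r = cls p + cls q ->
  minzs [:: p, q & s] -> minzs v ->
  lb_nontrivial_len [:: p, q & s] v m -> lb_nontrivial_len (r :: s) v m.-1.
Proof.
move=> rpq mu mv lb k hk k2.
have := haslen_pair_ge2 (minzs_merge rpq mu) mv hk.
case: (haslen_unmerge rpq hk) => [/lb/(_ k2)|/lb] lk k2'; first by lia.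
by have := lk _; lia.
Qed.

(** An atom [w] dividing [u] equals [u]; then [v] would be the product of the remaining atoms, of
    which there are at least two. *)
Lemma atom_not_sub u v ws w s : minzs u -> minzs v -> decomp (u ++ v) ws ->
  (2 < size ws)%N -> w \in ws -> ~ perm_eq u (w ++ s).
Proof.
move=> mu mv d sz wws e.
have [[w0 zw _] e' d' sz'] := decomp_rem d wws.
have [s0 uw] := minzs_sub mu e zw w0.
have ev : perm_eq v (flatten (rem w ws)) by perm_count.
have : haslen v (size (rem w ws)).
  by exists (rem w ws); split=> //; apply: decomp_perm d'; rewrite perm_sym.
by move/(haslen_minzs mv); lia.
Qed.

Lemma atom_cross u v ws w : minzs u -> minzs v -> decomp (u ++ v) ws ->
  (2 < size ws)%N -> w \in ws ->
  exists a b s t, [/\ perm_eq u (a ++ s), perm_eq v (b ++ t), perm_eq w (a ++ b),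
    a <> [::] & b <> [::]].
Proof.
move=> mu mv d sz wws.
have [_ e _ _] := decomp_rem d wws.
have [a [s [b [t [eu ev ew _]]]]] := perm_cat_split e.
exists a, b, s, t; split=> // n0; rewrite n0 ?cats0 /= in ew.
- have d' : decomp (v ++ u) ws by apply: decomp_perm d; rewrite perm_catC.
  by apply: (atom_not_sub mv mu d' sz wws (s := t)); perm_count.
- by apply: (atom_not_sub mu mv d sz wws (s := s)); perm_count.
Qed.

(* Merging two terms of [u] that lie in the same atom of the factorization
   keeps its length [m], while the least nontrivial length drops by at most 1. *)
Lemma daleth_merge_inside n m :
  (forall u v ws, (size u + size v < n)%N -> minzs u -> minzs v ->
     decomp (u ++ v) ws -> size ws = m -> lb_nontrivial_len u v m -> zs_daleth m.-1) ->
  (forall g, exists p, cls p = g) -> (4 <= m)%N ->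
  forall u v ws w p q a b s, (size u + size v <= n)%N -> minzs u -> minzs v ->
     decomp (u ++ v) ws -> size ws = m -> lb_nontrivial_len u v m ->
     w \in ws -> perm_eq u [:: p, q & a ++ s] -> perm_eq w [:: p, q & a ++ b] ->
     zs_daleth m.-1.
Proof.
move=> IH hprime m4 u v ws w p q a b s szn mu mv d szm lb wws eu ew.
have [r rpq] := hprime (cls p + cls q).
have mu' := minzs_perm eu mu.
have lb' : lb_nontrivial_len [:: p, q & a ++ s] v m.
  by move=> k hk; apply: lb; apply: haslen_perm hk; perm_count.
have mu2 := minzs_merge rpq mu'.
have lb2 := lb_merge rpq mu' mv lb'.
have [mw e d' szr] := decomp_rem d wws.
have mw2 := minzs_merge rpq (minzs_perm ew mw).
have d2 : decomp ((r :: a ++ s) ++ v) ((r :: a ++ b) :: rem w ws).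
  by apply: decomp_perm (decomp_cons mw2 d'); perm_count.
(* If m - 1 is a length after the merge, it is the least nontrivial one. Otherwise the lower bound m
   - 1 improves to m, and induction applies to the shorter pair. *)
have [h|nh] := pselect (haslen ((r :: a ++ s) ++ v) m.-1).
  by exists (r :: a ++ s), v; split=> //; lia.
apply: (IH _ _ _ _ mu2 mv d2); rewrite /=.
- by have /= := perm_size eu; lia.
- by rewrite -szr.
- move=> k hk k2; have := lb2 _ hk k2.
  have : k <> m.-1 by move=> km; apply: nh; rewrite -km.
  by lia.
Qed.

Lemma size1P (T : eqType) (s : seq T) : s <> [::] -> (size s <= 1)%N -> exists x, s = [:: x].
Proof. by case: s => [|x [|]] // _ _; exists x. Qed.

Lemma zs_dalethB m : (forall g, exists p, cls p = g) ->
  (4 <= m)%N -> zs_daleth m -> zs_daleth m.-1.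
Proof.
move=> hprime m4 [u [v [mu mv _ [ws [d szm]] lb]]].
have [n] := ubnP (size u + size v).
elim: n u v ws mu mv d szm lb => // n IH u v ws mu mv d szm lb.
rewrite ltnS => szn; have {}IH u' v' ws' : (size u' + size v' < n)%N -> minzs u' -> minzs v' ->
    decomp (u' ++ v') ws' -> size ws' = m -> lb_nontrivial_len u' v' m -> zs_daleth m.-1.
  by move=> *; apply: (IH u' v' ws').
have ws3 : (2 < size ws)%N by lia.
have dC : decomp (v ++ u) ws by apply: decomp_perm d; rewrite perm_catC.
(* Of three terms of [w], two come from the same factor, [u] or [v], and can be merged inside
   [w]. *)
have [/hasP[w wws w3]|nw] := boolP (has (fun w => 2 < size w)%N ws).
  have [a [b [s [t [eu ev ew a0 b0]]]]] := atom_cross mu mv d ws3 wws.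
  case: a a0 eu ew => [//|p [|q a]] _ eu ew.
    case: b b0 ev ew => [//|p' [|q' b]] _ ev ew; first by move: w3; rewrite (perm_size ew).
    apply: (daleth_merge_inside IH hprime m4 _ mv mu dC szm (lb_nontrivial_lenC lb) wws ev
      (b := [:: p])); first by lia.
    by perm_count.
  exact: (daleth_merge_inside IH hprime m4 szn mu mv d szm lb wws eu ew).
have le2 w : w \in ws -> (size w <= 2)%N.
  by move=> wws; move/hasPn/(_ w wws): nw; lia.
(* Now each atom consists of one term of [u] and one term of [v]; [w1] and [w2] are two of them. *)
case: ws szm d dC ws3 le2 {nw} => [|w1 [|w2 ws]] //= szm d dC ws3 le2.
have w1in := mem_head w1 (w2 :: ws).
have w2in : w2 \in [:: w1, w2 & ws] by rewrite !inE eqxx orbT.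
have [a1 [b1 [s1 [t1 [eu1 ev1 ew1 a10 b10]]]]] := atom_cross mu mv d ws3 w1in.
have e1 : perm_eq (s1 ++ t1) (w2 ++ flatten ws).
  by case: d => _ /= e; perm_count.
have [a2 [s2 [b2 [t2 [eu2 ev2 ew2 _]]]]] := perm_cat_split e1.
have a20 : a2 <> [::].
  move=> n0; rewrite n0 in ew2.
  by apply: (atom_not_sub mv mu dC ws3 w2in (s := b1 ++ t2)); perm_count.
have b20 : b2 <> [::].
  move=> n0; rewrite n0 in ew2.
  by apply: (atom_not_sub mu mv d ws3 w2in (s := a1 ++ s2)); perm_count.
have nz (T : eqType) (x : seq T) : x <> [::] -> (0 < size x)%N by case: x.
have := le2 _ w1in; rewrite (perm_size ew1) size_cat => l1.
have := le2 _ w2in; rewrite (perm_size ew2) size_cat => l2.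
have [x1 ?] : exists x, a1 = [:: x] by apply: size1P => //; have := nz _ _ b10; lia.
have [y1 ?] : exists x, b1 = [:: x] by apply: size1P => //; have := nz _ _ a10; lia.
have [x2 ?] : exists x, a2 = [:: x] by apply: size1P => //; have := nz _ _ b20; lia.
have [y2 ?] : exists x, b2 = [:: x] by apply: size1P => //; have := nz _ _ a20; lia.
subst a1 b1 a2 b2.
have zw w : w \in [:: w1, w2 & ws] -> sg w = 0 by case: d => dw _ /dw[].
have z1 : cls x1 + cls y1 = 0.
  by have := zw _ w1in; rewrite (sg_perm cls ew1) !sg_cons sg_nil addr0.
have z2 : cls x2 + cls y2 = 0.
  by have := zw _ w2in; rewrite (sg_perm cls ew2) !sg_cons sg_nil addr0.
(* Replacing x1 and x2 by [r] turns [w1] and [w2] into the single atom r y1 y2, which produces the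
   length m - 1. *)
have [r rx] := hprime (cls x1 + cls x2).
have eu : perm_eq u [:: x1, x2 & s2] by perm_count.
have ev : perm_eq v [:: y1, y2 & t2] by perm_count.
have ryy : cls r + cls y1 + cls y2 = 0.
  by rewrite rx -addrA addrACA z1 z2 addr0.
have y10 : cls y1 <> 0.
  move=> yz; have [||//] := @minzs_sub _ _ cls v [:: y1] (y2 :: t2) mv ev.
  - by rewrite sg_cons sg_nil yz addr0.
  - by [].
have y20 : cls y2 <> 0.
  move=> yz; have [|||//] := @minzs_sub _ _ cls v [:: y2] (y1 :: t2) mv; first by perm_count.
  - by rewrite sg_cons sg_nil yz addr0.
  - by [].
(* If [r] had class 0, then x1 x2 would be all of [u] and y1 y2 all of [v], leaving no terms for a
   third atom. *)
have r0 : cls r <> 0.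
  move=> rz; have zx : sg [:: x1; x2] = 0 by rewrite !sg_cons sg_nil addr0 -rx.
  have zy : sg [:: y1; y2] = 0 by move: ryy; rewrite !sg_cons sg_nil addr0 rz add0r.
  have [||s20 _] := @minzs_sub _ _ cls u [:: x1; x2] s2 mu eu; [exact: zx | by [] |].
  have [||t20 _] := @minzs_sub _ _ cls v [:: y1; y2] t2 mv ev; [exact: zy | by [] |].
  have f0 : flatten ws = [::].
    apply: perm_nil_r; rewrite s20 in eu2; rewrite t20 in ev2; perm_count.
  case: (ws) f0 ws3 d => [//|w ws'] f0 _ [dw _].
  have [w0 _ _] : minzs w by apply: dw; rewrite !inE eqxx !orbT.
  by apply: w0; case: (w) f0.
have mr := minzs3 r0 y10 y20 ryy.
have mu' := minzs_perm eu mu.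
have lb' : lb_nontrivial_len [:: x1, x2 & s2] v m.
  by move=> k hk; apply: lb; apply: haslen_perm hk; perm_count.
exists (r :: s2), v; split=> //.
- exact: (minzs_merge rx mu').
- by lia.
- have dd : decomp ([:: r; y1; y2] ++ flatten ws) ([:: r; y1; y2] :: ws).
    apply: decomp_cons => //; apply: decomp_self => w wws.
    by apply: d.1; rewrite !inE wws !orbT.
  exists ([:: r; y1; y2] :: ws); split; last by rewrite /= -szm.
  by apply: decomp_perm dd; perm_count.
- exact: lb_merge rx mu' mv lb'.
Qed.

Lemma zs_daleth_down m k : (forall g, exists p, cls p = g) ->
  zs_daleth m -> (3 <= k <= m)%N -> zs_daleth k.
Proof.
move=> hprime; have [n] := ubnP (m - k); elim: n m k => // n IH m k ltn dm km.
have [->//|/eqP nkm] := eqVneq k m.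
by apply: (IH m.-1) => //; [lia | apply: zs_dalethB => //; lia | lia].
Qed.

Lemma zs_daleth_of_len u v m : minzs u -> minzs v -> haslen (u ++ v) m ->
  (2 < m)%N -> exists k, [/\ zs_daleth k, haslen (u ++ v) k & (k <= m)%N].
Proof.
move=> mu mv; have [n] := ubnP m; elim: n m => // n IH m ltn hm m3.
have [lb|nlb] := pselect (lb_nontrivial_len u v m).
  by exists m; split=> //; exists u, v.
have [k [hk k2 km]] : exists k, [/\ haslen (u ++ v) k, k <> 2%N & (k < m)%N].
  apply: contrapT => nex; apply: nlb => k hk k2; rewrite leqNgt; apply/negP => km.
  by apply: nex; exists k.
have k3 := haslen_pair_ge2 mu mv hk.
by have [||j [dj hj jk]] := IH k _ hk; [lia | lia | exists j; split=> //; lia].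
Qed.

Lemma perm_map_split (T T' : eqType) (f : T -> T') (l : seq T) (l1 l2 : seq T') :
  perm_eq (map f l) (l1 ++ l2) ->
  exists k1 k2, [/\ perm_eq l (k1 ++ k2), perm_eq l1 (map f k1) & perm_eq l2 (map f k2)].
Proof.
elim: l1 l => [|x l1 IH] l e; first by exists [::], l; split; rewrite ?(perm_sym l2).
have /mapP[y yl xy] : x \in map f l by rewrite (perm_mem e) mem_head.
have el := perm_to_rem yl.
have : perm_eq (map f (rem y l)) (l1 ++ l2).
  have el' := perm_map f el; rewrite /= -xy in el'.
  by rewrite -(perm_cons x); perm_count.
case/IH=> k1 [k2 [e1 e2 e3]]; exists (y :: k1), k2; split=> //.
- by apply: seq.perm_trans el _; rewrite /= perm_cons.
- by rewrite /= xy perm_cons.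
Qed.

(** * The product of an atom and its negative *)

Section Negation.

Variable sec : G -> P.
Hypothesis secK : cancel sec cls.

Definition opp_seq u := [seq sec (- cls x) | x <- u].

Lemma sg_opp_seq u : sg (opp_seq u) = - sg u.
Proof.
elim: u => [|x u IH]; first by rewrite /= sg_nil oppr0.
by rewrite /= !sg_cons IH secK opprD.
Qed.

Lemma minzs_opp_seq u : minzs u -> minzs (opp_seq u).
Proof.
move=> [u0 zu mu]; split.
- by case: (u) u0.
- by rewrite sg_opp_seq zu oppr0.
- move=> s1 s2 /perm_map_split[u1 [u2 [e e1 e2]]] z1.
  have zu1 : sg u1 = 0.
    by move: z1; rewrite (sg_perm cls e1) sg_opp_seq => /eqP; rewrite oppr_eq0 => /eqP.
  by case: (mu _ _ e zu1) => n0; [left|right]; apply: perm_nil_r; move: e1 e2; rewrite n0.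
Qed.

Lemma minzs_nz u x : minzs u -> (1 < size u)%N -> x \in u -> cls x <> 0.
Proof.
move=> mu su /perm_split[r er] x0.
have [||r0 _] := @minzs_sub _ _ cls u [:: x] r mu er; [|by []|].
  by rewrite sg_cons sg_nil x0 addr0.
by have := perm_size er; rewrite r0 /=; lia.
Qed.

(** Each term is paired with the prime chosen in the opposite class. *)
Lemma haslen_opp_seq u : (forall x, x \in u -> cls x <> 0) -> haslen (u ++ opp_seq u) (size u).
Proof.
elim: u => [|x u IH] nz; first by exists [::]; split=> //; apply: decomp_nil.
have [|ws [d sz]] := IH; first by move=> y yu; apply: nz; rewrite inE yu orbT.
have m2 : minzs [:: x; sec (- cls x)].
  by apply: minzs2; [apply: nz; rewrite mem_head | rewrite secK subrr].
exists ([:: x; sec (- cls x)] :: ws); split; last by rewrite /= sz.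
by apply: decomp_perm (decomp_cons m2 d); rewrite /opp_seq /=; perm_count.
Qed.

Lemma zs_daleth_exists u : minzs u -> (2 < size u)%N ->
  exists2 k, zs_daleth k & (k <= size u)%N.
Proof.
move=> mu u3; have hl : haslen (u ++ opp_seq u) (size u).
  by apply: haslen_opp_seq => x; apply: (minzs_nz mu); lia.
by have [k [dk _ ku]] := zs_daleth_of_len mu (minzs_opp_seq mu) hl u3; exists k.
Qed.

Let cnt g s := count (fun x => cls x == g) s.

Lemma cnt_opp_seq g u : cnt g (opp_seq u) = cnt (- g) u.
Proof.
rewrite /cnt /opp_seq count_map; apply: eq_count => x /=.
by rewrite secK eqr_oppLR.
Qed.

(** A zero-sum pair consists of opposite classes, so it contributes equally to [g] and [- g], and
    contributes an even number when these coincide. *)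
Lemma cnt_pairs g ws : (forall w, w \in ws -> minzs w /\ size w = 2%N) ->
  cnt g (flatten ws) = cnt (- g) (flatten ws) /\
  (g = - g -> ~~ odd (cnt g (flatten ws))).
Proof.
elim: ws => [|w ws IH] h; first by [].
have [|e1 e2] := IH; first by move=> v vws; apply: h; rewrite inE vws orbT.
have [[_ zw _]] := h _ (mem_head _ _).
case: w zw {h} => [|x [|y []]] //=; rewrite !sg_cons sg_nil addr0 => /eqP.
rewrite addrC addr_eq0 => /eqP yx _.
rewrite /cnt /= yx eqr_opp eqr_oppLR -!/(cnt _ _); split; first by rewrite e1; lia.
by move=> g2; rewrite -g2 !oddD (negbTE (e2 g2)); case: (cls x == g).
Qed.

(* If one atom [w] were long and all others had length 2, then [w] would be
   symmetric under negation of classes, up to an even number of elements of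
   order 2, so it would contain a proper zero-sum pair. *)
Lemma one_long_atom u w ws : perm_eq (u ++ opp_seq u) (w ++ flatten ws) ->
  minzs w -> (forall v, v \in ws -> minzs v /\ size v = 2%N) -> size w = 2%N.
Proof.
move=> e mw h.
have [w0 zw _] := mw.
have [x [w1 ew]] : exists x w1, perm_eq w (x :: w1).
  by case: (w) w0 => // x w1; exists x, w1.
have [p1 p2] := cnt_pairs (cls x) h.
have cA g : (cnt g u + cnt (- g) u = cnt g w + cnt g (flatten ws))%N.
  by rewrite -cnt_opp_seq /cnt -!count_cat; apply/permP.
have cw g : cnt g w = ((cls x == g) + cnt g w1)%N by rewrite /cnt (permP ew).
(* By [cA] and [p1], [w] has as many terms of class g = [cls x] as of class -g. If g = -g, then [cA]
   and [p2] make their number in [w] even, so [x] is not the only one. *)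
have h1 : (0 < cnt (- cls x) w1)%N.
  have c1 := cA (cls x); have c2 := cA (- cls x); rewrite opprK in c2.
  have d1 := cw (cls x); have d2 := cw (- cls x); rewrite eqxx in d1.
  have [g2|/eqP g2] := eqVneq (cls x) (- cls x).
    have := p2 g2; rewrite -g2 in c1 d2 *.
    by lia.
  by move: d2; rewrite (negPf (introN eqP g2)); lia.
have [y yw1 /eqP yx] : exists2 y, y \in w1 & cls y == - cls x by apply/hasP; rewrite has_count.
have [r er] := perm_split yw1.
have [|||r0 _] := @minzs_sub _ _ cls w [:: x; y] r mw.
- by perm_count.
- by rewrite !sg_cons sg_nil yx addr0 subrr.
- by [].
- by rewrite (perm_size ew) /= (perm_size er) r0.
Qed.

(** A factorization into pairs has length [size u]. A single exceptional atom is excluded by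
    [one_long_atom], and two of them already use all 2 |u| terms, so the length is then 2. *)
Lemma zs_daleth_two_lengths u : minzs u -> (2 < size u)%N ->
  (forall w r, minzs w -> perm_eq (u ++ opp_seq u) (w ++ r) -> size w = 2%N \/ size w = size u) ->
  zs_daleth (size u).
Proof.
move=> mu u3 cond; have mv := minzs_opp_seq mu.
exists u, (opp_seq u); split=> //.
  by apply: haslen_opp_seq => x; apply: (minzs_nz mu); lia.
move=> k [ws [d szk]] k2.
have sz2 : size (u ++ opp_seq u) = (2 * size u)%N.
  by rewrite size_cat /opp_seq size_map; lia.
have sizes2 ws' : (forall w, w \in ws' -> size w = 2%N) -> size (flatten ws') = (2 * size ws')%N.
  elim: ws' => // w ws' IH h; rewrite /= size_cat h ?mem_head // IH; first by lia.
  by move=> v vin; apply: h; rewrite inE vin orbT.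
have [/hasP[w wws /eqP w2]|nh] := boolP (has (fun w => size w != 2%N) ws); last first.
  have := perm_size d.2; rewrite sz2 sizes2; first by lia.
  by move=> w wws; apply/eqP; move/hasPn/(_ w wws): nh; rewrite negbK.
have [mw e d' szw] := decomp_rem d wws.
have wn : size w = size u by case: (cond _ _ mw e).
have [/hasP[v vin /eqP v2]|nh] := boolP (has (fun w => size w != 2%N) (rem w ws)); last first.
  case: w2; apply: (one_long_atom e mw) => v vin; split; first exact: d'.1.
  by apply/eqP; move/hasPn/(_ v vin): nh; rewrite negbK.
have [mv' e' d'' szv] := decomp_rem d' vin.
have vn : size v = size u.
  case: (cond v (w ++ flatten (rem v (rem w ws))) mv') => //.
  by perm_count.
have f0 : flatten (rem v (rem w ws)) = [::].
  apply: size0nil; have := perm_size e; rewrite sz2 size_cat (perm_size e') size_cat.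
  by lia.
by rewrite f0 in d''; move: szv szw k2; rewrite (decomp_nilP d'') /=; lia.
Qed.

(** * Lists built from independent elements *)

Definition lincomb (es : seq G) (cs : seq int) : G := \sum_(x <- zip es cs) x.1 *~ x.2.

Lemma lincomb_cons e es c cs : lincomb (e :: es) (c :: cs) = e *~ c + lincomb es cs.
Proof. by rewrite /lincomb big_cons. Qed.

Lemma lincomb_nil cs : lincomb [::] cs = 0.
Proof. by rewrite /lincomb; case: cs => [|c cs]; rewrite big_nil. Qed.

Definition subs (cs ds : seq int) := [seq x.1 - x.2 | x <- zip cs ds].

Lemma lincombB es cs ds : size cs = size es -> size ds = size es ->
  lincomb es (subs cs ds) = lincomb es cs - lincomb es ds.
Proof.
elim: es cs ds => [|e es IH] [|c cs] [|d ds] //=.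
  by rewrite !lincomb_nil subr0.
by move=> [h1] [h2]; rewrite /subs /= !lincomb_cons IH // mulrzBr opprD addrACA.
Qed.

Lemma lincombN es cs : lincomb es (map -%R cs) = - lincomb es cs.
Proof.
elim: es cs => [|e es IH] [|c cs] //=; rewrite ?lincomb_nil ?oppr0 //.
  by rewrite /lincomb /= big_nil oppr0.
by rewrite !lincomb_cons IH mulrNz opprD.
Qed.

(** The l1 norm. It equals the number of terms of a list with these coefficients once no two of its
    terms cancel. *)
Definition weight (cs : seq int) := sumn (map absz cs).

(** The pair attached to an element e records the multiplicities of the primes chosen for e and -e.
    Every divisor of such a list has the same shape with smaller pairs, so its sum is read off from
    a coefficient vector. *)
Definition blocks (es : seq G) (ab : seq (nat * nat)) :=
  flatten [seq nseq x.2.1 (sec x.1) ++ nseq x.2.2 (sec (- x.1)) | x <- zip es ab].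

Definition coefs (ab : seq (nat * nat)) : seq int := [seq x.1%:Z - x.2%:Z | x <- ab].

Lemma sg_nseq m x : sg (nseq m x) = cls x *+ m.
Proof. by elim: m => [|m IH]; rewrite /= ?sg_nil ?mulr0n // sg_cons IH mulrS. Qed.

Lemma sg_blocks es ab : sg (blocks es ab) = lincomb es (coefs ab).
Proof.
elim: es ab => [|e es IH] [|[a b] ab] //; rewrite ?lincomb_nil //= ?sg_nil //.
  by rewrite /lincomb /= big_nil.
rewrite /blocks /= -/(blocks es ab) !sg_cat IH !sg_nseq !secK lincomb_cons /=.
by rewrite mulrzBr -!pmulrn mulNrn.
Qed.

Lemma nseq_sub (T : eqType) m (x : T) (l k : seq T) : perm_eq (nseq m x) (l ++ k) ->
  l = nseq (size l) x /\ (size l <= m)%N.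
Proof.
move=> e; split; last by have := perm_size e; rewrite size_cat size_nseq; lia.
apply/all_pred1P/allP => y yl.
have: y \in nseq m x by rewrite (perm_mem e) mem_cat yl.
by rewrite mem_nseq => /andP[].
Qed.

Definition le_pair (x y : nat * nat) := (x.1 <= y.1)%N && (x.2 <= y.2)%N.

Lemma blocks_sub es bs w r : size bs = size es -> perm_eq (blocks es bs) (w ++ r) ->
  exists ab, [/\ size ab = size es, all2 le_pair ab bs & perm_eq w (blocks es ab)].
Proof.
elim: es bs w r => [|e es IH] [|[a b] bs] //= w r; rewrite /blocks /=.
  move=> _; rewrite perm_sym => /perm_nil_r.
  by case: w => // _; exists [::].
move=> [szb]; rewrite -/(blocks es bs) => /perm_cat_split[s1 [s2 [t1 [t2 [e1 e2 e3 _]]]]].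
have [ab [sz le et]] := IH _ _ _ szb e2.
have [p1 [p2 [q1 [q2 [f1 f2 f3 _]]]]] := perm_cat_split e1.
have [n1 l1] := nseq_sub f1; have [n2 l2] := nseq_sub f2.
exists ((size p1, size q1) :: ab); rewrite /= /le_pair /= l1 l2 sz; split=> //.
by rewrite /blocks /= -n1 -n2 -/(blocks es ab); perm_count.
Qed.

Definition nopair s := forall x y r, perm_eq s [:: x, y & r] -> cls x + cls y <> 0.

Lemma nopair_catr s t : nopair (s ++ t) -> nopair t.
Proof. by move=> h x y r e; apply: (h x y (s ++ r)); perm_count. Qed.

Lemma size_blocks_nopair es ab : size ab = size es -> nopair (blocks es ab) ->
  size (blocks es ab) = weight (coefs ab).
Proof.
elim: es ab => [|e es IH] [|[a b] ab] //= [szab].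
rewrite /blocks /= -/(blocks es ab) => np.
rewrite size_cat IH //; last exact: nopair_catr np.
rewrite /weight /coefs /= size_cat !size_nseq.
suff: a = 0%N \/ b = 0%N by lia.
case: a np => [|a] np; [by left | right]; case: b np => // b np.
case: (np (sec e) (sec (- e)) (nseq a (sec e) ++ nseq b (sec (- e)) ++ blocks es ab)).
  by perm_count.
by rewrite !secK subrr.
Qed.

Section Independent.

Variables (es : seq G) (ns : seq nat).
Hypothesis sz_ns : size ns = size es.
Hypothesis ns_gt1 : all (leq 2) ns.
(** The range |c_i| <= n_i is that of differences of two vectors bounded by n_i/2, and it is the
    form in which an infinite group supplies families with all n_i = 2. *)
Hypothesis indep : forall cs, size cs = size es ->
  all2 (fun c n => `|c| <= n)%N cs ns -> lincomb es cs = 0 ->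
  all2 (fun c n => n %| `|c|)%N cs ns.

Let ms : seq int := [seq (n./2)%:Z | n <- ns].
Let e0 := - lincomb es ms.
Let bs := [seq (n./2, n./2) | n <- ns].
Let u := sec e0 :: blocks es [seq (n./2, 0%N) | n <- ns].

(** Since n_i divides c_i and |c_i| <= n_i/2 < n_i, every c_i vanishes. *)
Lemma indep0 cs : size cs = size es ->
  all2 (fun c n => `|c| <= n./2)%N cs ns -> lincomb es cs = 0 -> weight cs = 0%N.
Proof.
move=> szc le z.
have le' : all2 (fun c n => `|c| <= n)%N cs ns.
  elim: (cs) (ns) le => [|c l IH] [|n k] //= /andP[h /IH->].
  by rewrite andbT; lia.
have := indep szc le' z; rewrite /weight.
move: le ns_gt1; elim: (cs) (ns) => [|c l IH] [|n k] //=.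
move=> /andP[le lek] /andP[n2 n2k] /andP[dv dvk]; rewrite (IH k) // addn0.
have [//|pos] := posnP `|c|%N.
by have := dvdn_leq pos dv; lia.
Qed.

(** With m_i the integer part of n_i/2, the number c_i - m_i is a multiple of n_i between -2 m_i and
    0. Hence c_i = m_i, or n_i is even and c_i = -m_i; both have absolute value m_i. *)
Lemma indep1 cs : size cs = size es ->
  all2 (fun c n => `|c| <= n./2)%N cs ns -> lincomb es cs = lincomb es ms ->
  weight cs = sumn (map half ns).
Proof.
move=> szc le z.
have szm : size ms = size es by rewrite size_map.
have szs : size (subs cs ms) = size es by rewrite size_map size_zip szc szm minnn.
have le' : all2 (fun c n => `|c| <= n)%N (subs cs ms) ns.
  rewrite /ms; elim: (cs) (ns) le => [|c l IH] [|n k] //= /andP[h /IH->].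
  by rewrite andbT; lia.
have := indep szs le'; rewrite lincombB // z subrr => /(_ erefl).
rewrite /ms /weight; elim: (cs) (ns) le => [|c l IH] [|n k] //=.
move=> /andP[le lek] /andP[dv dvk]; rewrite (IH k) //; congr (_ + _)%N.
have [|pos] := posnP `|c - (n./2)%:Z|%N; first by lia.
by have := dvdn_leq pos dv; lia.
Qed.

Lemma weightN cs : weight (map -%R cs) = weight cs.
Proof. by rewrite /weight -map_comp; congr sumn; apply: eq_map => c /=; rewrite abszN. Qed.

Lemma coefs_bound ab : all2 le_pair ab bs ->
  all2 (fun c n => `|c| <= n./2)%N (coefs ab) ns.
Proof.
rewrite /bs; elim: ab (ns) => [|[a b] ab IH] [|n k] //= /andP[/andP[/= l1 l2] /IH->].
by rewrite andbT; lia.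
Qed.

Lemma size_coefs ab : size (coefs ab) = size ab.
Proof. by rewrite size_map. Qed.

Lemma sg_atom0 : sg u = 0.
Proof.
rewrite sg_cons secK sg_blocks /e0 /coefs -map_comp.
by rewrite (eq_map (g := fun n => (n./2)%:Z)) ?addNr // => n /=; rewrite subr0.
Qed.

Lemma blocks_sub_pos s r : perm_eq (blocks es [seq (n./2, 0%N) | n <- ns]) (s ++ r) ->
  sg s = 0 -> s = [::].
Proof.
move=> e zs; have [|ab [sz le es']] := blocks_sub _ e; first by rewrite size_map.
have le' : all2 le_pair ab bs.
  rewrite /bs; elim: (ab) (ns) le => [|[a b] l IH] [|n k] //= /andP[/andP[/= l1 l2] /IH->].
  by rewrite /le_pair /= l1 andbT; lia.
have szc : size (coefs ab) = size es by rewrite size_coefs.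
have w0 : weight (coefs ab) = 0%N.
  by apply: indep0 => //; [exact: coefs_bound | rewrite -sg_blocks -(sg_perm cls es')].
apply: size0nil; rewrite (perm_size es'); move: w0 le sz.
rewrite /weight /blocks; elim: (es) (ab) (ns) => [|e' l IH] [|[a b] l'] [|n k] //=.
move=> w0 /andP[/andP[/= l1 l2] lek] [sz].
rewrite size_cat (IH l' k) //; last by lia.
by rewrite size_cat !size_nseq; lia.
Qed.

Lemma size_atom : size u = (1 + sumn (map half ns))%N.
Proof.
rewrite /u /= add1n; congr _.+1; rewrite /blocks.
elim: (es) (ns) sz_ns => [|e l IH] [|n k] //= [sz].
by rewrite size_cat IH // size_cat !size_nseq addn0.
Qed.

(** The part of a splitting that avoids the term [e0] involves only the e_i, with exponents at most
    n_i/2, so independence makes it empty. *)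
Lemma minzs_atom : minzs u.
Proof.
split; [by [] | exact: sg_atom0 |].
move=> s1 s2 e zs1.
have zs2 : sg s2 = 0 by have := sg_atom0; rewrite (sg_perm cls e) sg_cat zs1 add0r.
have: sec e0 \in s1 ++ s2 by rewrite -(perm_mem e) mem_head.
rewrite mem_cat => /orP[] /perm_split[t et].
- right; apply: (@blocks_sub_pos s2 t) => //.
  by rewrite -(perm_cons (sec e0)); rewrite /u in e; perm_count.
- left; apply: (@blocks_sub_pos s1 t) => //.
  by rewrite -(perm_cons (sec e0)); rewrite /u in e; perm_count.
Qed.

Lemma perm_atom_opp : perm_eq (u ++ opp_seq u) ([:: sec e0; sec (- e0)] ++ blocks es bs).
Proof.
have : perm_eq (blocks es [seq (n./2, 0%N) | n <- ns] ++
    opp_seq (blocks es [seq (n./2, 0%N) | n <- ns])) (blocks es bs).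
  rewrite /blocks /bs; elim: (es) (ns) => [|e l IH] [|n k] //=.
  have := IH k; rewrite /opp_seq !map_cat => {}IH.
  have -> : [seq sec (- cls x) | x <- nseq n./2 (sec e)] = nseq n./2 (sec (- e)).
    by rewrite map_nseq secK.
  by rewrite cats0; perm_count.
by rewrite /u /opp_seq /= secK => ?; perm_count.
Qed.

(** An atom of size other than 2 contains no zero-sum pair, so it contains at most one of [e0] and
    [- e0]. Without either it would be empty by [indep0]; with one of them its coefficients solve
    the equation of [indep1] up to sign, so it is as long as [u]. *)
Lemma zs_daleth_indep : (2 < 1 + sumn (map half ns))%N ->
  zs_daleth (1 + sumn (map half ns)).
Proof.
rewrite -size_atom => u3; apply: (zs_daleth_two_lengths minzs_atom u3) => w r mw e.
have [->|/eqP w2] := eqVneq (size w) 2%N; [by left | right].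
have np : nopair w.
  move=> x y t ew xy0; have [||t0 _] := @minzs_sub _ _ cls w [:: x; y] t mw ew.
  - by rewrite !sg_cons sg_nil addr0.
  - by [].
  - by apply: w2; rewrite (perm_size ew) t0.
have [w0 zw _] := mw.
have e' : perm_eq ([:: sec e0; sec (- e0)] ++ blocks es bs) (w ++ r).
  by have := perm_atom_opp; move=> ?; perm_count.
(* Here [a1] is what [w] takes from the two extra terms and [b1] what it takes from the blocks. *)
have [a1 [a2 [b1 [b2 [f1 f2 f3 _]]]]] := perm_cat_split e'.
have [|ab [sz le eb]] := blocks_sub _ f2; first by rewrite size_map.
have szc : size (coefs ab) = size es by rewrite size_coefs.
have npb : nopair (blocks es ab).
  by move=> x y t et; apply: (np x y (a1 ++ t)); perm_count.
have cb := coefs_bound le.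
have szb : size b1 = weight (coefs ab) by rewrite (perm_size eb) size_blocks_nopair.
have zb : sg b1 = lincomb es (coefs ab) by rewrite (sg_perm cls eb) sg_blocks.
have zab : sg a1 + sg b1 = 0 by rewrite -sg_cat -(sg_perm cls f3).
have szw := perm_size f3; rewrite size_cat in szw.
have one x : a1 = [:: x] -> x \in [:: sec e0; sec (- e0)].
  by move=> a1x; rewrite (perm_mem f1) a1x mem_head.
case: a1 f1 f3 zab szw one => [|x [|y a1]] f1 f3 zab szw one.
- case: w0; apply: size0nil; rewrite szw szb; apply: indep0 => //.
  by rewrite -zb -[RHS]zab sg_nil add0r.
- have zb1 : sg b1 = - cls x.
    by apply/eqP; rewrite -addr_eq0 addrC -zab sg_cons sg_nil addr0.
  have {one} := one _ erefl; rewrite szw szb size_atom !inE => /orP[]/eqP xe.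
  + rewrite (@indep1 (coefs ab)) //.
    by rewrite -zb zb1 xe secK /e0 opprK.
  + rewrite -weightN (@indep1 (map -%R (coefs ab))) ?size_map //.
    * by elim: (coefs ab) (ns) cb => [|c l IH] [|n k] //= /andP[h /IH->]; rewrite andbT abszN.
    * by rewrite lincombN -zb zb1 xe secK /e0 !opprK.
- have := perm_size f1; rewrite size_cat /= => sz1.
  have a20 : a1 = [::] /\ a2 = [::] by split; apply: size0nil; lia.
  case: (np x y b1); first by case: a20 f3 => -> _ f3.
  have := sg_perm cls f1; case: a20 => -> ->.
  by rewrite cats0 !sg_cons sg_nil !addr0 !secK subrr.
Qed.

End Independent.
End Negation.

(** * Bounds from the Davenport constant *)

Section Davenport.

Variables (sec : G -> P) (D : nat).
Hypothesis secK : cancel sec cls.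
Hypothesis minzs_le : forall s, minzs s -> (size s <= D)%N.

(** Adding a term of class minus the sum gives a zero-sum list of more than [D] terms, which is not
    an atom. One of its atoms avoids the added term. *)
Lemma minzs_sub_of_size s : (D <= size s)%N ->
  exists t r, minzs t /\ perm_eq s (t ++ r).
Proof.
move=> Ds; have zs : sg (sec (- sg s) :: s) = 0 by rewrite sg_cons secK addNr.
have [ws d] := decomp_exists zs.
have /flattenP[w wws] : sec (- sg s) \in flatten ws by rewrite -(perm_mem d.2) mem_head.
move=> /perm_split[t et].
have [mw e d' _] := decomp_rem d wws.
case: (rem w ws) e d' => [|v vs] e d'.
  have := minzs_le mw; have := perm_size e; rewrite /= cats0; lia.
have [mv e' _ _] := decomp_rem d' (mem_head _ _).
rewrite /= eqxx in e'; exists v, (t ++ flatten vs); split=> //.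
by rewrite -(perm_cons (sec (- sg s))); perm_count.
Qed.

(** By [atom_cross] each of the m atoms has at least two terms, so 2m <= |u| + |v| <= 2D. *)
Lemma zs_daleth_le m : zs_daleth m -> (m <= D)%N.
Proof.
move=> [u [v [mu mv m3 [ws [d szm]] _]]].
have ws3 : (2 < size ws)%N by rewrite szm.
have w2 w : w \in ws -> (2 <= size w)%N.
  move=> wws; have [a [b [s [t [_ _ ew a0 b0]]]]] := atom_cross mu mv d ws3 wws.
  rewrite (perm_size ew) size_cat; case: a a0 {ew} => // x a _; case: b b0 => // y b _ /=.
  by lia.
have sz : (2 * size ws <= size (flatten ws))%N.
  elim: (ws) w2 => // w l IH h /=; rewrite size_cat.
  have h1 : (2 * size l <= size (flatten l))%N.
    by apply: IH => v' vl; apply: h; rewrite inE vl orbT.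
  by have := h _ (mem_head _ _); lia.
have := perm_size d.2; rewrite size_cat.
by have := minzs_le mu; have := minzs_le mv; lia.
Qed.

End Davenport.

Lemma perm_mask_cat (T : eqType) (m : bitseq) (l : seq T) :
  exists k, perm_eq l (mask m l ++ k).
Proof.
elim: l m => [|x l IH] [|b m] /=; try by exists [::].
  by exists (x :: l).
have [k e] := IH m; case: b; first by exists k; rewrite /= perm_cons.
by exists (x :: k); perm_count.
Qed.

Lemma min_zero_sum_map s : minzs s -> min_zero_sum (map cls s).
Proof.
move=> ms; have [s0 zs _] := ms; split; first by case: (s) s0.
  by rewrite big_map.
move=> m; rewrite -map_mask => n0; rewrite big_map => z.
have [k e] := perm_mask_cat m s.
have n0' : mask m s <> [::] by move=> n1; apply: n0; rewrite n1.
have [k0 _] := minzs_sub ms e z n0'.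
by rewrite !size_map (perm_size e) k0 cats0.
Qed.

Lemma minzs_map (sec : G -> P) (l : seq G) : cancel sec cls ->
  min_zero_sum l -> minzs (map sec l).
Proof.
move=> secK [l0 zl ml].
have sg_sec k : sg (map sec k) = \sum_(g <- k) g.
  by rewrite /Fdeg big_map; apply: eq_bigr => g _; rewrite secK.
split; [by case: (l) l0 | by rewrite sg_sec |].
move=> s1 s2 /perm_map_split[k1 [k2 [e e1 e2]]].
rewrite (sg_perm cls e1) sg_sec => zk1.
have [g gl e3] : exists2 g, subseq g l & perm_eq k1 g.
  by apply/count_subseqP => x; rewrite (permP e) count_cat leq_addr.
have [k10|/eqP k10] := eqVneq k1 [::].
  by left; apply: perm_nil_r; rewrite k10 in e1.
right; case/subseqP: gl => m _ gm; rewrite gm in e3.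
have mn0 : mask m l <> [::] by move=> n0; apply: k10; rewrite n0 in e3; apply: perm_nil_r.
have := ml m mn0; rewrite -(perm_big _ e3) => /(_ zk1).
have := perm_size e3; have := perm_size e; rewrite size_cat => h1 h2 h3.
have k20 : k2 = [::].
  by apply: size0nil; apply/eqP; rewrite -(eqn_add2l (size k1)) addn0 -h1 h2 h3.
by apply: perm_nil_r; rewrite k20 in e2.
Qed.

(** * Elements with two different factorizations of length 2 *)

Definition bifactored := exists s1 s2 t1 t2,
  [/\ minzs s1, minzs s2, minzs t1 & minzs t2] /\
  [/\ perm_eq (s1 ++ s2) (t1 ++ t2), ~ perm_eq s1 t1 & ~ perm_eq s1 t2].

(** The relation is (a b s)(r r') = (r s)(a b r') with r of class a + b and r' of the opposite
    class. Since a b s has at least four terms, its size differs from those of both atoms on the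
    right. *)
Lemma bifactored_long (sec : G -> P) u : cancel sec cls ->
  minzs u -> (4 <= size u)%N -> bifactored.
Proof.
move=> secK; case: u => [|a [|b s]] //= mu; rewrite 2!ltnS => s2.
set r := sec (cls a + cls b); set r' := sec (- (cls a + cls b)).
have rab : cls r = cls a + cls b by rewrite secK.
have mr := minzs_merge rab mu.
have nz x : x \in [:: a, b & s] -> cls x <> 0 by apply: minzs_nz.
have r0 : cls r <> 0 by apply: (minzs_nz mr); rewrite ?mem_head //=; lia.
exists [:: a, b & s], [:: r; r'], (r :: s), [:: a; b; r'].
split; split=> //; try by move/perm_size => /=; lia.
- by apply: minzs2; rewrite // !secK subrr.
- apply: minzs3; rewrite ?secK ?subrr //.
  + by apply: nz; rewrite mem_head.
  + by apply: nz; rewrite !inE eqxx orbT.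
  + by move/eqP; rewrite oppr_eq0 -rab => /eqP.
- by perm_count.
Qed.

(** For a class of order 2 the relation is (p p)(q q) = (p q)(p q); otherwise it is (p p r)(q q r) =
    (p q r)(p q r) with r in the class of -2p. *)
Lemma bifactored_two_primes (sec : G -> P) p q : cancel sec cls ->
  p <> q -> cls p = cls q -> cls p <> 0 -> bifactored.
Proof.
move=> secK pq cpq p0.
have [g2|/eqP g2] := eqVneq (cls p + cls p) 0.
  exists [:: p; p], [:: q; q], [:: p; q], [:: p; q].
  have npq : ~ perm_eq [:: p; p] [:: p; q].
    move/perm_mem/(_ q); rewrite !inE eqxx orbT orbb => /eqP qp.
    by apply: pq.
  by split; split; try apply: minzs2; rewrite -?cpq //; perm_count.
set r := sec (- (cls p + cls p)).
have r0 : cls r <> 0 by rewrite secK => /eqP; rewrite oppr_eq0 => /eqP.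
exists [:: p; p; r], [:: q; q; r], [:: p; q; r], [:: p; q; r].
have nz : cls q <> 0 by rewrite -cpq.
have npq : ~ perm_eq [:: p; p; r] [:: p; q; r].
  move/permP/(_ (pred1 p)) => /=; rewrite eqxx.
  have -> : (q == p) = false by apply/eqP => qp; apply: pq.
  by lia.
split; split=> //; try (by apply: minzs3; rewrite // -?cpq secK subrr); by perm_count.
Qed.

Lemma size1_cls s : size s = 1%N -> exists2 x, s = [:: x] & sg s = cls x.
Proof. by case: s => [|x []] // _; exists x; rewrite // sg_cons sg_nil addr0. Qed.

(** Refine to a = a1 a2, b = b1 b2, c = a1 b1, d = a2 b2. Then a1 and b2 have equal sums, and so do
    a2 and b1. By symmetry a1 has at most one term. If a1 or b2 is empty, then a = d by minimality.
    If b2 is one term, it is the same prime as a1 and again a = d. Otherwise the bound 3 makes a2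
    and b1 single terms, hence the same prime, and a = c. *)
Lemma unique_pairs (a b c d : seq P) :
  (forall s, minzs s -> (size s <= 3)%N) ->
  (forall p q, cls p = cls q -> cls p <> 0 -> p = q) ->
  minzs a -> minzs b -> minzs c -> minzs d -> perm_eq (a ++ b) (c ++ d) ->
  perm_eq a c \/ perm_eq a d.
Proof.
move=> le3 uniqp ma mb mc md e.
have [a1 [a2 [b1 [b2 [ea eb ec ed]]]]] := perm_cat_split e.
wlog sz1 : c d a1 a2 b1 b2 mc md e ea eb ec ed / (size a1 <= size a2)%N.
  move=> W; have [|] := leqP (size a1) (size a2); first exact: (W c d _ _ b1 b2).
  move=> lt; have [||||||||h|h] := W d c a2 a1 b2 b1 => //; try by perm_count.
  - by lia.
  - by right.
  - by left.
have [a0 za _] := ma; have [b0 zb _] := mb; have [c0 zc _] := mc; have [d0 zd _] := md.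
have := za; rewrite (sg_perm cls ea) sg_cat => /eqP; rewrite addr_eq0 => /eqP za1.
have := zb; rewrite (sg_perm cls eb) sg_cat => /eqP; rewrite addr_eq0 => /eqP zb1.
have := zc; rewrite (sg_perm cls ec) sg_cat => /eqP; rewrite addr_eq0 => /eqP zc1.
have := zd; rewrite (sg_perm cls ed) sg_cat => /eqP; rewrite addr_eq0 => /eqP zd1.
have la := le3 _ ma; rewrite (perm_size ea) size_cat in la.
have lb := le3 _ mb; rewrite (perm_size eb) size_cat in lb.
have [a10|/eqP a10] := eqVneq a1 [::].
  right; have ea2 : perm_eq a a2 by rewrite a10 in ea.
  have ed' : perm_eq d (a ++ b2) by perm_count.
  by have [_] := minzs_sub md ed' za a0; rewrite perm_sym.
have l1 : (0 < size a1)%N by case: (a1) a10.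
have [x a1x clx] : exists2 x, a1 = [:: x] & sg a1 = cls x by apply: size1_cls; lia.
have x0 : cls x <> 0.
  apply: (minzs_nz ma); first by rewrite (perm_size ea) size_cat; lia.
  by rewrite (perm_mem ea) a1x mem_head.
have b2x y : b2 = [:: y] -> perm_eq a d.
  move=> b2y; have cy : cls y = cls x.
    by rewrite -clx za1 zd1 b2y sg_cons sg_nil addr0 opprK.
  have yx : y = x by apply: uniqp; rewrite cy.
  by rewrite b2y yx in ed; rewrite a1x in ea; perm_count.
have b1y y z : b1 = [:: y] -> a2 = [:: z] -> perm_eq a c.
  move=> b1y' a2z; have cy : cls y = cls z.
    move: za1 zc1; rewrite b1y' a2z !sg_cons sg_nil !addr0 => -> /eqP.
    by rewrite eqr_opp => /eqP.
  have yz : z = y.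
    apply: uniqp; rewrite // => z0; move: za1; rewrite a2z clx sg_cons sg_nil addr0 z0 oppr0.
    exact: x0.
  by rewrite b1y' -yz in ec; rewrite a1x a2z in ea *; rewrite a1x in ec; perm_count.
have [b20|/eqP b20] := eqVneq b2 [::].
  right; have ea2 : perm_eq d a2 by rewrite b20 cats0 in ed.
  have ea' : perm_eq a (d ++ a1) by perm_count.
  by have [_] := minzs_sub ma ea' zd d0.
have l2 : (0 < size b2)%N by case: (b2) b20.
have [sb2|sb2] := eqVneq (size b2) 1%N.
  by have [y b2y _] := size1_cls sb2; right; apply: b2x b2y.
have ld := le3 _ md; rewrite (perm_size ed) size_cat in ld.
have [y b1y' _] : exists2 y, b1 = [:: y] & sg b1 = cls y.
  apply: size1_cls.
  have b10 : b1 <> [::].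
    move=> b10; have eb2 : perm_eq b b2 by rewrite b10 in eb.
    have ed' : perm_eq d (b ++ a2) by perm_count.
    have [a20 _] := minzs_sub md ed' zb b0.
    by move: sz1 l1; rewrite a20 /=; lia.
  have : (0 < size b1)%N by case: (b1) b10.
  by move: sb2 => /eqP; lia.
have [z a2z _] : exists2 z, a2 = [:: z] & sg a2 = cls z.
  by apply: size1_cls; move: sb2 => /eqP; lia.
by left; apply: b1y b1y' a2z.
Qed.

(** The sums of the proper initial segments, including the empty one, are distinct: a coincidence
    would give a proper nonempty zero-sum sublist. *)
Lemma size_minzs_card (s : seq P) (l : seq G) : uniq l -> (forall g, g \in l) ->
  minzs s -> (size s <= size l)%N.
Proof.
move=> ul lG ms; pose f i := sg (take i s).
have fE i j : (i <= j)%N -> f j = f i + sg (take (j - i) (drop i s)).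
  by move=> ij; rewrite /f -{1}(subnKC ij) takeD sg_cat.
have inj : {in iota 0 (size s) &, injective f}.
  suff W i j : (i < j)%N -> (j < size s)%N -> f i <> f j.
    move=> i j; rewrite !mem_iota /= !add0n => li lj fij.
    by case: (ltngtP i j) => // h; [case: (W i j) | case: (W j i)].
  move=> ij js; rewrite (fE i j (ltnW ij)) => /esym/eqP.
  rewrite -subr_eq0 addrAC subrr add0r => /eqP z.
  have e : perm_eq s (take (j - i) (drop i s) ++ (take i s ++ drop (j - i) (drop i s))).
    by rewrite -{1}(cat_take_drop i s) -{1}(cat_take_drop (j - i) (drop i s)); perm_count.
  have [|r0 _] := minzs_sub ms e z.
    by move/(congr1 size); rewrite size_take size_drop /=; case: ltnP; lia.
  move/(congr1 size): r0; rewrite size_cat size_drop size_drop /=.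
  by lia.
rewrite -(size_iota 0 (size s)) -(size_map f).
by apply: uniq_leq_size => //; rewrite map_inj_in_uniq // iota_uniq.
Qed.

(** * Independent families of elements *)

Lemma infinite_indep (n : nat) : ~ grp_finite G ->
  exists es : seq G, size es = n /\ forall cs, size cs = size es ->
    all2 (fun c k => `|c| <= k)%N cs (nseq n 2) -> lincomb es cs = 0 ->
    all2 (fun c k => k %| `|c|)%N cs (nseq n 2).
Proof.
move=> infG.
have [f fP] : exists f : G -> G, forall y, (exists x, x *+ 2 = y) -> f y *+ 2 = y.
  suff /boolp.choice[f fP] : forall y : G, exists z : G, (exists x, x *+ 2 = y) -> z *+ 2 = y.
    by exists f.
  move=> y.
  by have [[x xy]|n'] := pselect (exists x, x *+ 2 = y); [exists x | exists 0].
have fresh (l : seq G) : exists e, e \notin l /\ (e *+ 2 = 0 \/ e *+ 2 \notin l).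
  apply: contrapT => nex; apply: infG.
  have h e : e \notin l -> e *+ 2 <> 0 /\ e *+ 2 \in l.
    move=> el; split; first by move=> e2; apply: nex; exists e; split=> //; left.
    by apply/negPn/negP => e2; apply: nex; exists e; split=> //; right.
  (* For [e] outside [l], the double 2e is nonzero and lies in [l]. As e - f(2e) is killed by
     doubling, it lies in [l] too, so finitely many elements would cover the group. *)
  exists (l ++ [seq f y + x | y <- l, x <- l]) => e; rewrite mem_cat.
  have [//|/h[_ e2]] := boolP (e \in l).
  apply/allpairsP; exists (e *+ 2, e - f (e *+ 2)); split=> //=; last by rewrite addrC subrK.
  apply/negPn/negP => /h[+ _]; case.
  by rewrite mulrnBl fP ?subrr //; exists e.
elim: n => [|n [es [sz ind]]]; first by exists [::]; split=> // [[]].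
have [cset csetP] : exists cset : seq int, forall c : int, (`|c| <= 2)%N -> c \in cset.
  by exists [:: -2; -1; 0; 1; 2] => c; rewrite !inE; lia.
have [S SP] : exists S : seq G, forall cs, size cs = size es ->
    all2 (fun c k => `|c| <= k)%N cs (nseq n 2) -> lincomb es cs \in S.
  rewrite -sz; elim: (es) => [|e l [S SP]].
    by exists [:: 0] => -[] // _ _; rewrite lincomb_nil mem_head.
  exists [seq e *~ c + x | c <- cset, x <- S] => -[//|c cs] /= [szc] /andP[c2 cs2].
  rewrite lincomb_cons; apply: (allpairs_f (fun (c : int) (x : G) => e *~ c + x)); last exact: SP.
  exact: csetP.
have [e [eS e2S]] := fresh (S ++ map -%R S).
exists (e :: es); split; first by rewrite /= sz.
case=> [//|c cs] /= [szc] /andP[c2 cs2]; rewrite lincomb_cons => z.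
have zc : e *~ c = - lincomb es cs by apply/eqP; rewrite -addr_eq0 z.
have yS := SP _ szc cs2.
have nyS : e *~ c \in map -%R S by rewrite zc map_f.
(* A coefficient 1 or -1 would put [e] into S or -S, and a coefficient 2 or -2 would put 2e there
   unless 2e = 0; the choice of [e] excludes both. *)
have ec0 : e *~ c = 0 /\ (2 %| `|c|)%N.
  have /orP[/orP[/eqP c0|/orP[/eqP c1|/eqP c1]]|/orP[/eqP c1|/eqP c1]] :
    ((c == 0) || ((c == 1) || (c == -1))) || ((c == 2) || (c == -2)) by lia.
  - by rewrite c0 mulr0z.
  - by move: eS; rewrite mem_cat negb_or => /andP[_]; move: nyS; rewrite c1 mulr1z => ->.
  - have ee : e = lincomb es cs by apply/eqP; rewrite -eqr_opp -mulrN1z -c1 zc.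
    by move: eS; rewrite mem_cat negb_or {1}ee yS.
  - split; last by rewrite c1.
    case: e2S => [e2|]; first by rewrite c1 -pmulrn.
    by rewrite mem_cat negb_or => /andP[_]; move: nyS; rewrite c1 -pmulrn => ->.
  - split; last by rewrite c1.
    have zc' : e *+ 2 = lincomb es cs.
      by move: zc; rewrite c1 mulrNz -pmulrn => /eqP; rewrite eqr_opp => /eqP.
    case: e2S => [e2|]; first by rewrite c1 mulrNz -pmulrn e2 oppr0.
    by rewrite mem_cat negb_or => /andP[+ _]; rewrite zc' yS.
case: ec0 => ec0 ->; apply: ind => //.
by move: z; rewrite ec0 add0r.
Qed.

Lemma lincomb_nth (es : seq G) (cs : seq int) : size cs = size es ->
  lincomb es cs = \sum_(i < size es) nth 0 es i *~ nth 0 cs i.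
Proof.
elim: es cs => [|e es IH] [|c cs] //=; first by rewrite lincomb_nil big_ord0.
by move=> [sz]; rewrite lincomb_cons big_ord_recl /= IH.
Qed.

(** Reducing each coefficient modulo n_i gives a second representation of 0 besides the zero vector;
    by uniqueness all residues vanish. *)
Lemma Dstar_indep D : Dstar_eq G D -> exists (es : seq G) (ns : seq nat),
  [/\ size ns = size es, all (leq 2) ns, D = (1 + \sum_(k <- ns) (k - 1))%N &
    forall cs, size cs = size es -> lincomb es cs = 0 ->
      all2 (fun c n => n %| `|c|)%N cs ns].
Proof.
move=> [ns [es [[sz n2 _ ->] [ord uni]]]]; exists es, ns; split=> // cs szc z.
have nz i : (i < size ns)%N -> (0 < nth 0%N ns i)%N.
  by move=> li; have := all_nthP 0%N n2 i li; lia.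
pose ks := [seq `|(x.1 %% x.2%:Z)%Z|%N | x <- zip cs ns].
have szk : size ks = size ns by rewrite size_map size_zip szc sz minnn.
have nthk i : (i < size ns)%N -> nth 0%N ks i = `|(nth 0 cs i %% (nth 0%N ns i)%:Z)%Z|%N.
  move=> li; rewrite (nth_map (0, 0%N)) ?size_zip ?szc ?sz ?minnn //.
  by rewrite nth_zip ?szc ?sz.
have [k0 [_ kuniq]] := uni 0.
have e1 : k0 = nseq (size ns) 0%N.
  apply: kuniq; split; first by rewrite size_nseq.
    by move=> i li; rewrite nth_nseq li; apply: nz.
  by rewrite big1 // => i _; rewrite nth_nseq ltn_ord mulr0n.
have e2 : k0 = ks.
  apply: kuniq; split=> //.
    move=> i li; rewrite nthk //; have := nz _ li => n0.
    have := @ltz_pmod (nth 0 cs i) (nth 0%N ns i)%:Z.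
    by have := @modz_ge0 (nth 0 cs i) (nth 0%N ns i)%:Z; lia.
  rewrite -[LHS]z lincomb_nth // sz; apply: eq_bigr => i _; have li := ltn_ord i.
  rewrite nthk // pmulrn gez0_abs; last by apply: modz_ge0; have := nz _ li; lia.
  rewrite [in LHS](divz_eq (nth 0 cs i) (nth 0%N ns i)%:Z) mulrzDr mulrC mulrzA -pmulrn ord //.
  by rewrite mul0rz add0r.
rewrite all2E szc sz eqxx /=; apply/(all_nthP (0, 0%N)) => i.
rewrite size_zip szc sz minnn => li'.
rewrite nth_zip ?szc ?sz //=; have := nthk i li'; rewrite -e2 e1 nth_nseq li'.
move=> h; have : (nth 0 cs i %% (nth 0%N ns i)%:Z)%Z = 0 by lia.
by move/dvdz_mod0P; rewrite dvdzE.
Qed.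

End Lengths.

(** * Transfer to the Krull monoid *)

Lemma Perm_perm_eq (T : eqType) (s t : seq T) : Perm s t <-> perm_eq s t.
Proof.
split.
  elim=> [//|x l l' _ IH|x y l|l l' l'' _ IH1 _ IH2]; first by rewrite perm_cons.
    by perm_count.
  by apply: seq.perm_trans IH1 IH2.
elim: s t => [|x s IH] t e.
  by move/perm_size/esym/size0nil: e => ->; constructor.
have xt : x \in t by rewrite -(perm_mem e) mem_head.
case/splitPr: xt e => t1 t2 e.
apply: Permutation.Permutation_cons_app; apply: IH.
by rewrite -(perm_cons x); perm_count.
Qed.

Section Transfer.

Import GRing.Theory.
Local Open Scope ring_scope.

Variables (H : cmonoid) (P : eqType) (phi : H -> seq P) (G : zmodType) (cls : P -> G).
Hypothesis hK : Krull_with_class_group phi cls.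
Hypothesis hprime : forall g, exists p, cls p = g.
Implicit Types (a b x y : H) (z t v w : list H).

Local Notation sg := (Fdeg cls).
Local Notation minzs := (minzs cls).
Local Notation decomp := (decomp cls).
Local Notation haslen := (haslen cls).
Local Notation zs_daleth := (zs_daleth cls).
Local Notation lb_nontrivial_len := (lb_nontrivial_len cls).

Lemma class_section : exists sec : G -> P, cancel sec cls.
Proof. by have [f fP] := boolp.choice hprime; exists f. Qed.

Lemma phi1 : phi (mone H) = [::].
Proof. by case: hK => [[/Perm_perm_eq/perm_nilP]]. Qed.

Lemma phiM a b : perm_eq (phi (mmul a b)) (phi a ++ phi b).
Proof. by case: hK => [[_ h _ _ _] _]; apply/Perm_perm_eq. Qed.

Lemma phi_zs a : sg (phi a) = 0.
Proof.
case: hK => _ [h _]; rewrite -[RHS](sg_nil cls); apply/h.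
by exists a, (mone H); rewrite phi1 cats0; apply/Perm_perm_eq; rewrite /= perm_refl.
Qed.

Lemma mmulr1 a : mmul a (mone H) = a.
Proof. by rewrite mmulC mmul1. Qed.

Lemma munit1 : munit (mone H).
Proof. by exists (mone H); rewrite mmul1. Qed.

Lemma massoc_refl a : massoc a a.
Proof. by exists (mone H); rewrite mmulr1; split=> //; apply: munit1. Qed.

Lemma phi_unit a : munit a <-> phi a = [::].
Proof.
split=> [[b ab]|a0].
  have := phiM a b; rewrite ab phi1 perm_sym => /perm_nilP.
  by case: (phi a).
have [u [[w uw] ->]] : massoc (mone H) a.
  by case: hK => [[_ _ h _ _] _]; apply: h; rewrite phi1 a0; constructor.
by rewrite mmul1; exists w.
Qed.

Lemma massocP a b : massoc a b <-> perm_eq (phi a) (phi b).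
Proof.
split=> [[u [/phi_unit u0 ->]]|e].
  by rewrite perm_sym; have := phiM a u; rewrite u0 cats0.
by case: hK => [[_ _ h _ _] _]; apply/h/Perm_perm_eq.
Qed.

Lemma massoc_sym a b : massoc a b -> massoc b a.
Proof. by rewrite !massocP perm_sym. Qed.

(** A list of class 0 is a quotient of two images by the description of the class group, and the
    divisor homomorphism property realizes that quotient in [H]. *)
Lemma phi_surj s : sg s = 0 -> exists a, perm_eq (phi a) s.
Proof.
case: hK => [[_ _ _ hdvd _] [h _]]; rewrite -(sg_nil cls) => /h[a [b /Perm_perm_eq e]].
have [c ec] : mdvd b a.
  by apply: hdvd; exists s; apply/Perm_perm_eq; rewrite perm_catC.
exists c; have := phiM b c; rewrite -ec => e'.
by rewrite -(perm_cat2l (phi b)); perm_count.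
Qed.

Lemma atomP a : atom a <-> minzs (phi a).
Proof.
split=> [[na ha]|[a0 za ma]].
  split=> [a0||s1 s2 e z1]; [by apply: na; apply/phi_unit | exact: phi_zs |].
  have z2 : sg s2 = 0 by have := phi_zs a; rewrite (sg_perm cls e) sg_cat z1 add0r.
  have [b1 e1] := phi_surj z1; have [b2 e2] := phi_surj z2.
  have [u [/phi_unit u0 ea]] : massoc (mmul b1 b2) a.
    by apply/massocP; have := phiM b1 b2 => ?; perm_count.
  rewrite -mmulA in ea; have e3 := phiM b2 u; rewrite u0 cats0 in e3.
  case: (ha _ _ ea) => /phi_unit b0; [left|right]; apply: perm_nil_r.
    by rewrite perm_sym -b0.
  by rewrite -b0; perm_count.
split=> [/phi_unit //|b c bc].
have e : perm_eq (phi a) (phi b ++ phi c) by rewrite bc phiM.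
by case: (ma _ _ e (phi_zs b)) => h0; [left|right]; apply/phi_unit.
Qed.

Definition phis z := flatten (map phi z).

Lemma phis_cons x z : phis (x :: z) = phi x ++ phis z.
Proof. by []. Qed.

Lemma phis_cat z t : phis (z ++ t) = phis z ++ phis t.
Proof. by rewrite /phis map_cat flatten_cat. Qed.

Lemma phi_mprod z : perm_eq (phi (mprod z)) (phis z).
Proof.
elim: z => [|x z IH]; first by rewrite /mprod /= phi1.
by have := phiM x (mprod z); rewrite /phis /= -/(phis z) => ?; perm_count.
Qed.

Lemma phis_perm z t : Perm z t -> perm_eq (phis z) (phis t).
Proof.
elim=> [//|x l l' _ IH|x y l|l l' l'' _ IH1 _ IH2].
- by rewrite /phis /= perm_cat2l.
- by rewrite /phis /=; perm_count.
- by apply: seq.perm_trans IH1 IH2.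
Qed.

Lemma phis_assoc z t : List.Forall2 (@massoc H) z t -> perm_eq (phis z) (phis t).
Proof. by elim=> // x y l l' /massocP e _ IH; rewrite /phis /=; apply: perm_cat. Qed.

Lemma factorizationP a z :
  factorization a z <-> List.Forall (@atom H) z /\ perm_eq (phi a) (phis z).
Proof.
have e := phi_mprod z.
by split=> [[h /massocP e']|[h e']]; split=> //; [|apply/massocP]; perm_count.
Qed.

Lemma factorization_decomp a z : factorization a z -> decomp (phi a) (map phi z).
Proof.
move=> /factorizationP[h e]; split=> // s; elim: h {e} => //= x l /atomP mx _ IH.
by rewrite inE => /orP[/eqP->|/IH].
Qed.

Lemma decomp_lift s ws : decomp s ws -> exists z,
  [/\ List.Forall (@atom H) z, perm_eq s (phis z) & size z = size ws].
Proof.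
elim: ws s => [|w ws IH] s d.
  by exists [::]; split=> //; case: d.
have [[w0 zw mw] _ d' _] := decomp_rem d (mem_head _ _).
rewrite /= eqxx in d'; have [z [az ez szz]] := IH _ d'.
have [x ex] := phi_surj zw.
exists (x :: z); split; [|by case: d => _ /= e; rewrite phis_cons; perm_count|by rewrite /= szz].
constructor=> //; apply/atomP; apply: (@minzs_perm _ _ cls w); last by split.
by rewrite perm_sym.
Qed.

Lemma in_LP a k : in_L a k <-> haslen (phi a) k.
Proof.
split=> [[z [fz <-]]|[ws [d <-]]].
  by exists (map phi z); split; [exact: factorization_decomp | rewrite size_map].
have [z [az ez szz]] := decomp_lift d.
by exists z; split=> //; apply/factorizationP.
Qed.

Lemma in_L_mul a b k : in_L (mmul a b) k <-> haslen (phi a ++ phi b) k.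
Proof.
by rewrite in_LP; split; apply: haslen_perm; have := phiM a b => ?; perm_count.
Qed.

Lemma in_dalethP m : in_daleth H m <-> zs_daleth m.
Proof.
split=> [[a [b [/atomP ma [/atomP mb [_ /in_L_mul hm m2 lb]]]]]|[u [v [mu mv m3 hm lb]]]].
  exists (phi a), (phi b); split=> //.
    by have := haslen_pair_ge2 ma mb hm; lia.
  by move=> k /in_L_mul hk; apply: lb.
have [a ea] : exists a, perm_eq (phi a) u by apply: phi_surj; case: mu.
have [b eb] : exists b, perm_eq (phi b) v by apply: phi_surj; case: mv.
have ma : minzs (phi a) by apply: minzs_perm mu; rewrite perm_sym.
have mb : minzs (phi b) by apply: minzs_perm mv; rewrite perm_sym.
have L k : in_L (mmul a b) k <-> haslen (u ++ v) k.
  by rewrite in_L_mul; split; apply: haslen_perm; perm_count.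
exists a, b; split; [exact/atomP | split; [exact/atomP | split]].
- exists 2%N, m; split; [|exact/L|by lia].
  by apply/in_L_mul; apply: haslen_pair.
- exact/L.
- by lia.
- by move=> k /L; apply: lb.
Qed.

(** * Distances and chains of factorizations *)

Lemma Perm_size (T : Type) (l l' : list T) : Perm l l' -> size l = size l'.
Proof. by move/Permutation.Permutation_length. Qed.

Lemma Forall2_size (T U : Type) (R : T -> U -> Prop) l l' :
  List.Forall2 R l l' -> size l = size l'.
Proof. by elim=> //= x y k k' _ _ ->. Qed.

(** Associated atoms are cancelled one pair at a time until none is left. *)
Lemma fdist_exists z z' : exists d, fdist z z' d.
Proof.
have [n] := ubnP (size z); elim: n z z' => // n IH z z' ltn.
have [[x [y [xz yz' xy]]]|nex] := pselect (exists x y,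
    [/\ List.In x z, List.In y z' & massoc x y]); last first.
  exists (maxn (size z) (size z')), [::], [::], z, z'; split=> //.
  by move=> x y xz yz' xy; apply: nex; exists x, y.
have [z1 [z2 ez]] := List.in_split _ _ xz.
have [z1' [z2' ez']] := List.in_split _ _ yz'.
have [|_ [c [c' [v [w [e1 e2 cc vw _]]]]]] := IH (z1 ++ z2) (z1' ++ z2').
  by move: ltn; rewrite ez -[(_ ++ _)%list]/(z1 ++ x :: z2) !size_cat /=; lia.
exists (maxn (size v) (size w)), (x :: c), (y :: c'), v, w; split=> //.
- rewrite ez; apply: Permutation.Permutation_trans (Permutation.perm_skip x e1).
  exact/Permutation.Permutation_sym/Permutation.Permutation_middle.
- rewrite ez'; apply: Permutation.Permutation_trans (Permutation.perm_skip y e2).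
  exact/Permutation.Permutation_sym/Permutation.Permutation_middle.
- by constructor.
Qed.

Lemma fdist_bound z z' d : fdist z z' d -> (d <= maxn (size z) (size z'))%N.
Proof.
by move=> [c [c' [v [w [/Perm_size + /Perm_size + _ _ ->]]]]]; rewrite !size_cat; lia.
Qed.

Lemma fdist_sym z z' d : fdist z z' d -> fdist z' z d.
Proof.
move=> [c [c' [v [w [e1 e2 cc vw ->]]]]]; exists c', c, w, v; split=> //.
- by elim: cc => [|x y l l' xy _ IH]; constructor=> //; apply: massoc_sym.
- by move=> x y xw yv xy; apply: (vw y x yv xw); apply: massoc_sym.
- by rewrite maxnC.
Qed.

Lemma fdist_perm z z' : Perm z z' -> fdist z z' 0.
Proof.
move=> e; exists z', z', [::], [::]; split; rewrite ?cats0 //.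
by elim: (z') => [|x l IH]; constructor=> //; apply: massoc_refl.
Qed.

Lemma Forall_perm (R : H -> Prop) z z' : Perm z z' -> List.Forall R z -> List.Forall R z'.
Proof. exact: Permutation.Permutation_Forall. Qed.

Lemma Forall_cat (R : H -> Prop) z z' :
  List.Forall R (z ++ z') <-> List.Forall R z /\ List.Forall R z'.
Proof. exact: List.Forall_app. Qed.

Lemma phis_nil z : List.Forall (@atom H) z -> phis z = [::] -> z = [::].
Proof.
case=> // x l /atomP[x0 _ _] _; rewrite /phis /= => e.
by case: x0; case: (phi x) e.
Qed.

Lemma fdist_parts a z z' d : factorization a z -> factorization a z' -> fdist z z' d ->
  exists c c' v w, [/\ Perm z (c ++ v), Perm z' (c' ++ w), List.Forall2 (@massoc H) c c',
     forall x y, List.In x v -> List.In y w -> ~ massoc x y & d = maxn (size v) (size w)] /\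
  [/\ List.Forall (@atom H) v, List.Forall (@atom H) w, perm_eq (phis v) (phis w),
      size z = (size c + size v)%N & size z' = (size c + size w)%N].
Proof.
move=> /factorizationP[az ez] /factorizationP[az' ez'] [c [c' [v [w [e1 e2 cc vw ed]]]]].
exists c, c', v, w; split=> //.
have [_ av] := (Forall_cat _ _ _).1 (Forall_perm e1 az).
have [_ aw] := (Forall_cat _ _ _).1 (Forall_perm e2 az').
split=> //.
- have := phis_perm e1; have := phis_perm e2; have := phis_assoc cc.
  by rewrite !phis_cat -(perm_cat2l (phis c)) => *; perm_count.
- by rewrite (Perm_size e1) size_cat.
- by rewrite (Perm_size e2) size_cat (Forall2_size cc).
Qed.

Lemma atoms_prod_atom x z : atom x -> List.Forall (@atom H) z ->
  perm_eq (phi x) (phis z) -> size z = 1%N.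
Proof.
move=> /atomP mx az e; apply: (haslen_minzs mx); apply/in_LP.
by exists z; split=> //; apply/factorizationP.
Qed.

(* What remains of the shorter [z] after cancellation has at least two
   factors, since an atom has no other factorization. *)
Lemma fdist_gap a z z' d : factorization a z -> factorization a z' -> fdist z z' d ->
  (size z < size z')%N -> (2 + (size z' - size z) <= d)%N.
Proof.
move=> fz fz' dd lt.
have [c [c' [v [w [[_ _ _ _ ->] [av aw e sz sz']]]]]] := fdist_parts fz fz' dd.
case: v av e sz => [|x [|y v]] av e sz /=.
- have w0 : w = [::] by apply: phis_nil => //; apply: perm_nil_r; rewrite perm_sym.
  by move: lt; rewrite sz sz' w0 /=; lia.
- have ax : atom x by inversion av.
  have : size w = 1%N by apply: (atoms_prod_atom ax aw); rewrite /phis /= cats0 in e.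
  by move: lt sz sz' => /=; lia.
- by move: lt sz sz' => /=; lia.
Qed.

Lemma chain_fact a N z z' : chain a N z z' -> factorization a z /\ factorization a z'.
Proof. by elim=> [z1 ?|z1 y z2 f1 _ _ [_ ?]]. Qed.

(** Some step of the chain jumps over the gap, from length at most [l] to length at least
    [l + delta]; [fdist_gap] bounds its distance from below. *)
Lemma chain_gap a N z z' l delta : chain a N z z' -> (size z <= l)%N ->
  (l + delta <= size z')%N -> (0 < delta)%N ->
  (forall k, (l < k < l + delta)%N -> ~ in_L a k) -> (delta + 2 <= N)%N.
Proof.
move=> c zl lz' d0 gap; elim: c zl lz' => [z1 _|z1 y z2 f1 [d [dd dN]] c IH] zl lz'; first by lia.
have [fy _] := chain_fact c.
have [yl|ly] := leqP (size y) l; first exact: IH.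
have [ly'|yl'] := leqP (l + delta)%N (size y).
  by have := fdist_gap f1 fy dd; lia.
by case: (gap (size y)); [lia | exists y].
Qed.

Lemma chain_trans a N z t z' : chain a N z t -> chain a N t z' -> chain a N z z'.
Proof. elim=> // z1 y1 z2 f1 d1 _ IH c; exact: chain_cons f1 d1 (IH c). Qed.

Lemma chain1 a N z z' : factorization a z -> factorization a z' -> fdist_le z z' N ->
  chain a N z z'.
Proof. by move=> f f' d; apply: chain_cons d _ => //; apply: chain_nil. Qed.

Lemma chain_sym a N z z' : chain a N z z' -> chain a N z' z.
Proof.
elim=> [z1 f|z1 y z2 f1 [d [dd dN]] c IH]; first exact: chain_nil.
apply: (chain_trans IH); apply: chain1 => //; first by case: (chain_fact c).
by exists d; split=> //; apply: fdist_sym.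
Qed.

Lemma chain_mono a N M z z' : (N <= M)%N -> chain a N z z' -> chain a M z z'.
Proof.
move=> NM; elim=> [z1 f|z1 y z2 f1 [d [dd dN]] c IH]; first exact: chain_nil.
by apply: chain_cons IH => //; exists d; split=> //; lia.
Qed.

Lemma chain_perm a N z z' : factorization a z -> Perm z z' -> chain a N z z'.
Proof.
move=> f e; apply: chain1 => //; last by exists 0%N; split=> //; apply: fdist_perm.
move: f => /factorizationP[az ez]; apply/factorizationP; split; first exact: Forall_perm az.
by have := phis_perm e => ?; perm_count.
Qed.

Lemma chain_size a N z z' : factorization a z -> factorization a z' ->
  (size z <= N)%N -> (size z' <= N)%N -> chain a N z z'.
Proof.
move=> f f' l l'; apply: chain1 => //; have [d dd] := fdist_exists z z'.
by exists d; split=> //; have := fdist_bound dd; lia.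
Qed.

Lemma in_R_le_cat d : in_R H d -> le_cat H d.
Proof.
move=> [d2 [a [z [z' [f f' _ _ nc]]]]] N cN; rewrite leqNgt; apply/negP => Nd.
by apply: nc; apply: (chain_mono (N := N)); [lia | apply: cN].
Qed.

(** Compare u v with a factorization of length m. Their distance is at most m by size and at least 2
    + (m - 2) by [fdist_gap]; as no length lies strictly between 2 and m, [chain_gap] excludes an (m
    - 1)-chain. *)
Lemma daleth_in_R m : in_daleth H m -> in_R H m.
Proof.
move=> dm; have /in_dalethP[_ [_ [_ _ m3 _ _]]] := dm.
case: dm => u [v [au [av [_ [z' [fz' szz']] m2 lb]]]].
have fz : factorization (mmul u v) [:: u; v].
  apply/factorizationP; split; first by do 2 constructor=> //.
  by rewrite /phis /= cats0 phiM.
split; first by lia.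
exists (mmul u v), [:: u; v], z'; split=> //.
- by move=> [z'' [/Perm_size e1 /Forall2_size e2]]; move: e1 e2 => /=; lia.
- have [d dd] := fdist_exists [:: u; v] z'.
  have := fdist_bound dd; have := fdist_gap fz fz' dd; rewrite szz' /= => h1 h2.
  by have <- : d = m by lia.
- move=> c; have := @chain_gap _ _ _ _ 2 (m - 2) c; rewrite szz' /=.
  have gap k : (2 < k < 2 + (m - 2))%N -> ~ in_L (mmul u v) k.
    by move=> kk hk; have := lb _ hk; lia.
  by move/(_ isT) => h; have := h _ _ gap; lia.
Qed.

Lemma Delta_le_cat delta : in_Delta H delta -> le_cat H (2 + delta).
Proof.
move=> [a [l [[z [fz szz]] [z' [fz' szz']] d0 gap]]] N cN.
by have := chain_gap (cN a z z' fz fz') _ _ d0 gap; rewrite szz szz'; lia.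
Qed.

Lemma daleth_Delta m : in_daleth H m -> in_Delta H (m - 2) /\ (2 < m)%N.
Proof.
move=> dm; have /in_dalethP[_ [_ [_ _ m3 _ _]]] := dm; split=> //.
case: dm => u [v [au [av [_ hm m2 lb]]]].
exists (mmul u v), 2%N; split.
- by apply/in_L_mul; apply: haslen_pair; apply/atomP.
- by have -> : (2 + (m - 2))%N = m by lia.
- by lia.
- by move=> k kk hk; have := lb _ hk; lia.
Qed.

Lemma chain_cons_atom a b u N z z' : atom u -> perm_eq (phi b) (phi u ++ phi a) ->
  chain a N z z' -> chain b N (u :: z) (u :: z').
Proof.
move=> au e.
have F t : factorization a t -> factorization b (u :: t).
  move=> /factorizationP[ay ey]; apply/factorizationP; split; first by constructor.
  by rewrite /phis /= -/(phis t); perm_count.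
elim=> [y /F fy|y1 y y2 /F f1 [d [[c [c' [v [w [e1 e2 cc vw ->]]]]] dN]] _ IH].
  exact: chain_nil.
apply: chain_cons IH => //; exists (maxn (size v) (size w)); split=> //.
exists (u :: c), (u :: c'), v, w; split=> //.
- exact: Permutation.perm_skip.
- exact: Permutation.perm_skip.
- by constructor=> //; apply: massoc_refl.
Qed.

(** Riesz refinement for a whole factorization: the pair attached to an atom consists of the
    disjoint parts of it that fall into [s] and into [t]. *)
Lemma riesz_pair z (s t r : seq P) : perm_eq (phis z) (s ++ t ++ r) ->
  exists ps : seq (seq P * seq P),
    [/\ List.Forall2 (fun x p => exists q, perm_eq (phi x) (p.1 ++ p.2 ++ q)) z ps,
        perm_eq s (flatten (map fst ps)) & perm_eq t (flatten (map snd ps))].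
Proof.
elim: z s t r => [|x z IH] s t r e.
  exists [::]; split; first by constructor.
  - by have /= := perm_size e; case: s {e} => //= ? ? /esym; lia.
  - by have /= := perm_size e; rewrite !size_cat; case: t {e} => //= ? ?; lia.
rewrite phis_cons in e.
have [x1 [x2 [z1 [z2 [e1 e2 e3 e4]]]]] := perm_cat_split e.
have e4' : perm_eq (x2 ++ z2) (t ++ r) by rewrite perm_sym.
have [x3 [x4 [z3 [z4 [f1 f2 f3 f4]]]]] := perm_cat_split e4'.
have [|ps [ph e5 e6]] := IH z1 z3 z4; first by perm_count.
exists ((x1, x3) :: ps); split=> /=; [|perm_count|perm_count].
by constructor=> //; exists x4; perm_count.
Qed.

(** A factor that takes nothing from some atom [x] of [z] still divides the product of the other
    atoms. *)
Lemma drop_empty (ps : seq (seq P * seq P)) (f : seq P * seq P -> seq P) z :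
  List.Forall2 (fun x p => exists q, perm_eq (phi x) (f p ++ q)) z ps ->
  [::] \in map f ps ->
  exists x z' r, Perm z (x :: z') /\ perm_eq (phis z') (flatten (map f ps) ++ r).
Proof.
have sub z0 ps0 : List.Forall2 (fun x p => exists q, perm_eq (phi x) (f p ++ q)) z0 ps0 ->
    exists r, perm_eq (phis z0) (flatten (map f ps0) ++ r).
  elim=> [|x p l l' [q eq] _ [r er]]; first by exists [::].
  by exists (q ++ r); rewrite !phis_cons; perm_count.
elim=> // x p l l' [q eq] h IH; rewrite inE => /orP[/eqP p0|/IH[y [z' [r [e1 e2]]]]].
  have [r er] := sub _ _ h.
  by exists x, l, r; split=> //=; rewrite -p0.
exists y, (x :: z'), (q ++ r); split.
  by apply: Permutation.perm_trans (Permutation.perm_skip x e1) _; apply: Permutation.perm_swap.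
by rewrite !phis_cons; perm_count.
Qed.

(** * The catenary degree *)

Section CatenaryBound.

Variables N D : nat.
Hypothesis minzs_le : forall s, minzs s -> (size s <= D)%N.
Hypothesis D_N : (D./2 < N)%N.
Hypothesis N2 : (2 <= N)%N.
Hypothesis daleth_N : forall m, zs_daleth m -> (m <= N)%N.

Section Step.

Variable a : H.
Hypothesis IH : forall b, (size (phi b) < size (phi a))%N -> cat_elt_le b N.

(** Remove the shared atom, connect the rests by induction on size, and multiply the chain by that
    atom again. *)
Lemma chain_share u z z' t t' : factorization a z -> factorization a z' ->
  Perm z (u :: t) -> Perm z' (u :: t') -> chain a N z z'.
Proof.
move=> f f' e e'; have [az ez] := (factorizationP _ _).1 f.
have [az' ez'] := (factorizationP _ _).1 f'.
have [au [at1 au' at1']] : atom u /\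
    [/\ List.Forall (@atom H) t, atom u & List.Forall (@atom H) t'].
  by move: (Forall_perm e az) (Forall_perm e' az') => h h'; inversion h; inversion h'.
have p := phis_perm e; have p' := phis_perm e'.
rewrite phis_cons in p; rewrite phis_cons in p'.
have pt := phi_mprod t.
have tt' : perm_eq (phis t) (phis t').
  by rewrite -(perm_cat2l (phi u)); perm_count.
have c : chain (mprod t) N t t'.
  apply: IH; try by apply/factorizationP; split=> //; perm_count.
  rewrite (perm_size ez) (perm_size p) size_cat (perm_size pt).
  by case/atomP: au; case: (phi u) => // *; rewrite /=; lia.
apply: chain_trans (chain_perm N f e) _.
apply: chain_trans (chain_sym (chain_perm N f' e')).
by apply: chain_cons_atom c => //; perm_count.
Qed.

(** Two intermediate factorizations, one containing [u] and [x], the other [u'] and [x], make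
    consecutive factorizations share [u], then [x], then [u']. *)
Lemma chain_common_divisor u u' z z' t t' x r r' :
  factorization a z -> factorization a z' ->
  Perm z (u :: t) -> Perm z' (u' :: t') -> atom x ->
  perm_eq (phis t) (phi x ++ r) -> perm_eq (phis t') (phi x ++ r') -> chain a N z z'.
Proof.
move=> f f' e e' ax p p'.
have F (v : H) (y k : list H) (q : seq P) :
      factorization a y -> Perm y (v :: k) -> perm_eq (phis k) (phi x ++ q) ->
    exists l, factorization a [:: v, x & l].
  move=> /factorizationP[ay ey] ek pk.
  have zq : sg q = 0.
    have : sg (phis k) = 0 by rewrite -(sg_perm cls (phi_mprod k)) phi_zs.
    by rewrite (sg_perm cls pk) sg_cat phi_zs add0r.
  have [ws d] := decomp_exists zq; have [l [al el _]] := decomp_lift d.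
  exists l; apply/factorizationP; split.
    by have h := Forall_perm ek ay; inversion h; do 2 constructor=> //.
  have pk' := phis_perm ek; rewrite !phis_cons in pk'.
  by rewrite !phis_cons; perm_count.
have [l fl] := F _ _ _ _ f e p; have [l' fl'] := F _ _ _ _ f' e' p'.
apply: (chain_trans (chain_share f fl e (Permutation.Permutation_refl _))).
apply: (chain_trans (t := [:: u', x & l'])).
  apply: (chain_share (u := x) (t := u :: l) (t' := u' :: l') fl fl'); exact: Permutation.perm_swap.
exact: (chain_share fl' f' (Permutation.Permutation_refl _) e').
Qed.

(* If [v1] and [v2] both meet every atom of [z], then removing one atom [x]
   of [z] leaves at least [2 * (size z - 1) >= D] terms of [v1 v2], hence a
   zero-sum subsequence dividing both [v1 v2] and the product of the others. *)
Lemma chain_long z (v1 v2 v3 : H) (vs : list H) : factorization a z ->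
  factorization a [:: v1, v2, v3 & vs] -> (N < size z)%N ->
  chain a N z [:: v1, v2, v3 & vs].
Proof.
move=> f f' Nz; have [az ez] := (factorizationP _ _).1 f.
have [az' ez'] := (factorizationP _ _).1 f'.
have [av1 av2] : atom v1 /\ atom v2.
  by move: az' => /List.Forall_cons_iff[? /List.Forall_cons_iff[]].
have e : perm_eq (phis z) (phi v1 ++ phi v2 ++ phis (v3 :: vs)).
  by rewrite !phis_cons in ez' *; perm_count.
have [ps [h e1 e2]] := riesz_pair e.
have h1 : List.Forall2 (fun x p => exists q, perm_eq (phi x) (p.1 ++ q)) z ps.
  by elim: h => [|x p l l' [q pq] _ ?]; constructor=> //; exists (p.2 ++ q).
have h2 : List.Forall2 (fun x p => exists q, perm_eq (phi x) (p.2 ++ q)) z ps.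
  by elim: h => [|x p l l' [q pq] _ ?]; constructor=> //; exists (p.1 ++ q); perm_count.
(* If some atom of [z] misses [v1], then [v1] itself is a common divisor of what remains on both
   sides; likewise for [v2] below. *)
have [n1|n1] := boolP ([::] \in map fst ps).
  have [x [t [r [ex er]]]] := drop_empty h1 n1.
  apply: (chain_common_divisor (u' := v2) (t' := [:: v1, v3 & vs]) (x := v1)
    (r := r) (r' := phis (v3 :: vs)) f f' ex) => //.
  - exact: Permutation.perm_swap.
  - by perm_count.
have [n2|n2] := boolP ([::] \in map snd ps).
  have [x [t [r [ex er]]]] := drop_empty h2 n2.
  apply: (chain_common_divisor (u' := v1) (t' := [:: v2, v3 & vs]) (x := v2)
    (r := r) (r' := phis (v3 :: vs)) f f' ex) => //.
  by perm_count.
case: h h1 h2 f ez Nz e1 e2 n1 n2 {e az} => // x p us ps' [q pq] h _ _ f ez Nz e1 e2 n1 n2.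
have szps := Forall2_size h.
pose s := flatten (map fst ps') ++ flatten (map snd ps').
have ge_size (l : seq (seq P)) : [::] \notin l -> (size l <= size (flatten l))%N.
  elim: l => // w l IHl; rewrite inE negb_or => /andP[w0 /IHl]; rewrite /= size_cat.
  by case: w w0 => //= *; lia.
have szs : (D <= size s)%N.
  rewrite /s size_cat; move: n1 n2; rewrite /= !inE !negb_or.
  move=> /andP[_ /ge_size +] /andP[_ /ge_size].
  by rewrite !size_map; move: Nz; rewrite /=; lia.
have [sec secK] := class_section.
have [y [r [my er]]] := minzs_sub_of_size secK minzs_le szs.
have [b eb] : exists b, perm_eq (phi b) y by apply: phi_surj; case: my.
have [r' er'] : exists r', perm_eq (phis us) (s ++ r').
  rewrite /s; elim: h => [|x' p' l l' [q' pq'] _ [r' er']]; first by exists [::].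
  by exists (q' ++ r'); rewrite !phis_cons; perm_count.
(* The atoms set aside are [x] in [z] and [v3] on the other side; [b] divides both the product of
   [us] and v1 v2. *)
apply: (chain_common_divisor (u := x) (t := us) (u' := v3) (t' := [:: v1, v2 & vs]) (x := b)
    (r := r ++ r') (r' := r ++ p.1 ++ p.2 ++ phis vs) f f' (Permutation.Permutation_refl _)).
- apply: (Permutation.perm_trans (l' := [:: v1, v3, v2 & vs])).
    exact/Permutation.perm_skip/Permutation.perm_swap.
  exact: Permutation.perm_swap.
- by apply/atomP; apply: minzs_perm my; rewrite perm_sym.
- by perm_count.
- by rewrite !phis_cons; rewrite /s /= in er e1 e2; perm_count.
Qed.

Lemma cat_elt_step : cat_elt_le a N.
Proof.
suff W z z' : factorization a z -> factorization a z' -> (N < size z)%N -> chain a N z z'.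
  move=> z z' f f'; have [l|l] := ltnP N (size z); first exact: W.
  have [l'|l'] := ltnP N (size z'); first by apply: chain_sym; apply: W.
  exact: chain_size.
move=> f f' Nz.
have hz : haslen (phi a) (size z) by apply/in_LP; exists z.
case: z' f' => [|v1 [|v2 [|v3 vs]]] f'; last exact: chain_long.
- have [_ e] := (factorizationP _ _).1 f'.
  have [az ez] := (factorizationP _ _).1 f.
  have z0 : z = [::] by apply: phis_nil => //; apply: perm_nil_r; perm_count.
  by rewrite z0 in Nz.
- have /in_LP h1 : in_L a 1 by exists [:: v1].
  by have := haslen_minzs (haslen1 h1) hz; lia.
- have [av e] := (factorizationP _ _).1 f'.
  have [/atomP m1 /atomP m2] : atom v1 /\ atom v2.
    by move: av => /List.Forall_cons_iff[? /List.Forall_cons_iff[]].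
  have e' : perm_eq (phi a) (phi v1 ++ phi v2) by rewrite /phis /= cats0 in e.
  (* As [z] is longer than 2, v1 v2 has a least nontrivial length m, with 3 <= m <= N. A
     factorization [t] of that length is within distance N of [z'] and long enough for
     [chain_long]. *)
  have [|m [dm hm _]] := zs_daleth_of_len m1 m2 (haslen_perm e' hz); first by lia.
  have m3 : (2 < m)%N by case: dm => ? [? []].
  have mN := daleth_N dm.
  have [t [ft szt]] : in_L a m.
    by apply/in_LP; apply: haslen_perm hm; rewrite perm_sym.
  apply: (chain_trans (t := t)); last by apply: chain_size => //; lia.
  case: t ft szt => [|w1 [|w2 [|w3 ws]]] ft szt; try by move: szt => /=; lia.
  by apply: chain_long; rewrite // szt.
Qed.

End Step.

Lemma cat_le_bound : cat_le H N.
Proof.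
move=> a; have [n] := ubnP (size (phi a)); elim: n a => // n IH a ltn.
by apply: cat_elt_step => b lt; apply: IH; lia.
Qed.

End CatenaryBound.

(** * The distance 2 and small class groups *)

Definition multiplicity (s : seq P) z := count (perm_eq s) (map phi z).

Lemma multiplicity_perm s z z' : Perm z z' -> multiplicity s z = multiplicity s z'.
Proof.
rewrite /multiplicity.
elim=> [|x l l' _ IH|x y l|l l' l'' _ e1 _ e2] //=; [by rewrite IH | | by rewrite e1].
by rewrite addnCA.
Qed.

Lemma multiplicity_assoc s z z' : List.Forall2 (@massoc H) z z' ->
  multiplicity s z = multiplicity s z'.
Proof.
by rewrite /multiplicity; elim=> [|x y l l' /massocP/permPr e _ IH] //=; rewrite e IH.
Qed.

Lemma size_atoms_le1 v w :
  List.Forall (@atom H) v -> List.Forall (@atom H) w -> perm_eq (phis v) (phis w) ->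
  (size v <= 1)%N -> size w = size v.
Proof.
move=> av aw e; case: v av e => [|x [|//]] av e _.
  by have -> : w = [::] by apply: phis_nil => //; apply: perm_nil_r; rewrite perm_sym.
have ax : atom x by inversion av.
by apply: (atoms_prod_atom ax aw); rewrite phis_cons cats0 in e.
Qed.

(** Distance 1 does not occur, since two atoms with the same image are associated; what remains is
    equality up to order and associates. *)
Lemma fdist_le1_multiplicity s a z z' d : factorization a z -> factorization a z' ->
  fdist z z' d -> (d <= 1)%N -> multiplicity s z = multiplicity s z'.
Proof.
move=> f f' dd d1.
have [c [c' [v [w [[e1 e2 cc vw ed] [av aw e _ _]]]]]] := fdist_parts f f' dd.
have szw : size w = size v by apply: (size_atoms_le1 av aw e); lia.
case: v w szw vw ed e e1 e2 {av aw dd} => [|x [|x' v]] [|y [|y' w]] //= _ vw ed e e1 e2.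
- by rewrite (multiplicity_perm s e1) (multiplicity_perm s e2) !cats0; apply: multiplicity_assoc.
- by case: (vw x y); [left | left | apply/massocP; rewrite !phis_cons !cats0 in e].
- by move: d1; rewrite ed /=; lia.
Qed.

Lemma chain1_multiplicity s a z z' : chain a 1 z z' -> multiplicity s z = multiplicity s z'.
Proof.
elim=> [//|z1 y z2 f1 [d [dd d1]] c <-].
by case: (chain_fact c) => fy _; apply: fdist_le1_multiplicity f1 fy dd d1.
Qed.

(** The multiplicity of [s1] differs in the two factorizations but is constant along 1-chains. *)
Lemma in_R2_bifactored : bifactored cls -> in_R H 2.
Proof.
move=> [s1 [s2 [t1 [t2 [[ms1 ms2 mt1 mt2] [e n1 n2]]]]]].
have lift s : minzs s -> exists2 x, atom x & perm_eq (phi x) s.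
  move=> ms; have [x ex] : exists x, perm_eq (phi x) s by apply: phi_surj; case: ms.
  by exists x => //; apply/atomP; apply: minzs_perm ms; rewrite perm_sym.
have [x1 ax1 ex1] := lift _ ms1; have [x2 ax2 ex2] := lift _ ms2.
have [y1 ay1 ey1] := lift _ mt1; have [y2 ay2 ey2] := lift _ mt2.
pose a := mmul x1 x2; have ea := phiM x1 x2.
have f : factorization a [:: x1; x2].
  apply/factorizationP; split; first by do 2 constructor=> //.
  by rewrite !phis_cons cats0.
have f' : factorization a [:: y1; y2].
  apply/factorizationP; split; first by do 2 constructor=> //.
  by rewrite !phis_cons cats0 /a; perm_count.
have nm : multiplicity s1 [:: x1; x2] <> multiplicity s1 [:: y1; y2].
  rewrite /multiplicity /= (perm_sym s1 (phi x1)) ex1.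
  have -> : perm_eq s1 (phi y1) = false by rewrite (permPr ey1); apply/negP.
  by have -> : perm_eq s1 (phi y2) = false by rewrite (permPr ey2); apply/negP.
split=> //; exists a, [:: x1; x2], [:: y1; y2]; split=> //.
- move=> [z [e1 e2]]; apply: nm.
  by rewrite (multiplicity_perm s1 e1) (multiplicity_assoc s1 e2).
- have [d dd] := fdist_exists [:: x1; x2] [:: y1; y2].
  have := fdist_bound dd; rewrite /= => d2.
  have [d1|d1] := leqP d 1; first by case: nm; apply: fdist_le1_multiplicity f f' dd d1.
  by have <- : d = 2%N by lia.
- by move=> c; apply: nm; apply: chain1_multiplicity c.
Qed.

(** At distance 2, cancellation leaves two atoms against two atoms, and [unique_pairs] finds a
    further common one. *)
Lemma not_in_R2 : (forall s, minzs s -> (size s <= 3)%N) ->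
  (forall p q, cls p = cls q -> cls p <> 0 -> p = q) -> ~ in_R H 2.
Proof.
move=> le3 uniqp [_ [a [z [z' [f f' _ dd _]]]]].
have [c [c' [v [w [[e1 e2 cc vw ed] [av aw e _ _]]]]]] := fdist_parts f f' dd.
have [szv szw] : size v = 2%N /\ size w = 2%N.
  have h1 := size_atoms_le1 av aw e.
  have e' := e; rewrite perm_sym in e'.
  have h2 := size_atoms_le1 aw av e'.
  have [l|l] := leqP (size v) 1; first by have := h1 l; lia.
  have [l'|l'] := leqP (size w) 1; first by have := h2 l'; lia.
  by lia.
case: v w szv szw av aw vw e {e1 e2 ed}
  => [|x1 [|x2 [|x3 v]]] [|y1 [|y2 [|y3 w]]] //= _ _ av aw vw e.
have [/atomP m1 /atomP m2] : atom x1 /\ atom x2.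
  by move: av => /List.Forall_cons_iff[? /List.Forall_cons_iff[]].
have [/atomP m3 /atomP m4] : atom y1 /\ atom y2.
  by move: aw => /List.Forall_cons_iff[? /List.Forall_cons_iff[]].
rewrite !phis_cons !cats0 in e.
have [h|h] := unique_pairs le3 uniqp m1 m2 m3 m4 e.
- by apply: (vw x1 y1); [left | left | apply/massocP].
- by apply: (vw x1 y2); [left | right; left | apply/massocP].
Qed.

Lemma minzs_trivial s : (forall g : G, g = 0) -> minzs s -> exists p, s = [:: p].
Proof.
move=> G0 ms; have [s0 _ _] := ms; case: s s0 ms => // p s _ ms.
have [||s0 _] := @minzs_sub _ _ cls (p :: s) [:: p] s ms (perm_refl _); [exact: G0 | by [] |].
by exists p; rewrite s0.
Qed.

Lemma phis_mem p z : p \in phis z -> exists2 x, List.In x z & p \in phi x.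
Proof.
elim: z => // x z IH; rewrite phis_cons mem_cat => /orP[px|/IH[y yz py]].
  by exists x => //; left.
by exists y => //; right.
Qed.

(** Every atom is a single prime, so an atom left over on one side is associated to the atom on the
    other side that contains its prime. *)
Lemma trivial_not_in_R d : (forall g : G, g = 0) -> ~ in_R H d.
Proof.
move=> G0 [d2 [a [z [z' [f f' _ dd _]]]]].
have [c [c' [v [w [[_ _ _ vw ed] [av aw e _ _]]]]]] := fdist_parts f f' dd.
have v0 : v = [::].
  case: v av e vw {ed} => // x v av e vw.
  have [p px] : exists p, phi x = [:: p] by apply: minzs_trivial => //; apply/atomP; inversion av.
  have [y yw py] : exists2 y, List.In y w & p \in phi y.
    by apply: phis_mem; rewrite -(perm_mem e) phis_cons px mem_head.
  case: (vw x y); [by left | by [] |].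
  have [q yq] : exists p, phi y = [:: p].
    by apply: minzs_trivial => //; apply/atomP; move/List.Forall_forall: aw; apply.
  by apply/massocP; move: py; rewrite px yq inE => /eqP->.
rewrite v0 in ed e av.
by have := size_atoms_le1 av aw e isT; move: ed d2 => /=; lia.
Qed.

(* A prime divisor that is alone in its class of order 2 would not be a gcd
   of elements of [H]: each element of [H] divisible by it is divisible by its square. *)
Lemma order2_two_primes (g : G) : g <> 0 -> (forall h : G, h = 0 \/ h = g) ->
  exists p q, [/\ p <> q, cls p = g & cls q = g].
Proof.
move=> g0 Gg; have [p pg] := hprime g.
have [[q [pq qg]]|nex] := pselect (exists q, p <> q /\ cls q = g); first by exists p, q.
have uniqp q : cls q <> 0 -> q = p.
  move=> q0; apply: contrapT => qp; apply: nex; exists q; split; first by move/esym.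
  by case: (Gg (cls q)).
case: hK => [[_ _ _ _ /(_ [:: p])[l [hl /(_ [:: p; p]) hg]]] _].
have [|r /Perm_perm_eq/perm_size //] := hg.
elim: l hl {hg} => [|h l IH] /= hl; constructor.
  have [r /Perm_perm_eq e] : Fdiv [:: p] (phi h) by inversion hl.
  have zr : cls p + sg r = 0 by have := phi_zs h; rewrite -(sg_perm cls e) sg_cons.
  have [q qr q0] : exists2 q, q \in r & cls q <> 0.
    apply: contrapT => nx; apply: g0; rewrite -pg -zr.
    suff -> : sg r = 0 by rewrite addr0.
    rewrite /Fdeg big_seq big1 // => q qr; apply: contrapT => q0; apply: nx.
    by exists q.
  rewrite (uniqp q q0) in qr; have [r' er'] := perm_split qr.
  by exists r'; apply/Perm_perm_eq; rewrite /= in e *; perm_count.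
by apply: IH; inversion hl.
Qed.

(** * Proof of the assertions for primes with decidable equality *)

Lemma theorem_eqType :
  (forall x y w : nat, in_daleth H x -> in_daleth H w -> (x <= y <= w)%N ->
     in_daleth H y) /\
  (forall m, in_daleth H m -> in_R H m) /\
  (grp_finite G ->
   (exists n, [/\ Davenport_eq G n, Dstar_eq G n & (4 <= n)%N]) ->
   forall d,
     (in_R H d <-> in_daleth H d \/ d = 2%N) /\
     (in_R H d <-> (exists delta, in_Delta H delta /\ d = (2 + delta)%N) \/ d = 2%N) /\
     (in_R H d <-> (2 <= d)%N /\ le_cat H d)) /\
  ((grp_card G 1 -> forall d, ~ in_R H d) /\
   (grp_card G 2 -> forall d, in_R H d <-> d = 2%N) /\
   (~ grp_finite G -> forall d, in_R H d <-> (2 <= d)%N)) /\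
  (Davenport_eq G 3 ->
   (forall g : G, g <> 0 -> exists! p, cls p = g) ->
   forall d, (in_R H d <-> d = 3%N) /\ (in_daleth H d <-> d = 3%N)) /\
  ((Davenport_eq G 3 /\
      (exists g : G, g <> 0 /\ exists p q, [/\ p <> q, cls p = g & cls q = g])
    \/ Davenport_ge G 4) ->
   (in_R H 2 /\ forall d, in_R H d -> (2 <= d)%N) /\
   (in_daleth H 3 /\ forall d, in_daleth H d -> (3 <= d)%N)).
Proof.
have [sec secK] := class_section.
have ge3 m : zs_daleth m -> (2 < m)%N by case=> ? [? []].
have down := fun m k => @zs_daleth_down _ _ cls m k hprime.
have dav n s : Davenport_eq G n -> minzs s -> (size s <= n)%N.
  by move=> [_ h] /min_zero_sum_map/h; rewrite size_map.
have long (l : seq G) : min_zero_sum l -> exists2 s, minzs s & size s = size l.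
  by move=> ml; exists (map sec l); rewrite ?size_map //; apply: minzs_map.
have daleth3 s : minzs s -> (2 < size s)%N -> zs_daleth 3.
  move=> ms s3; have [k dk _] := zs_daleth_exists secK ms s3.
  by apply: (down k) => //; have := ge3 _ dk; lia.
have R2_long s : minzs s -> (4 <= size s)%N -> in_R H 2.
  by move=> ms s4; apply: in_R2_bifactored; apply: bifactored_long secK ms s4.
split; [|split; [|split; [|split; [|split]]]].
- move=> x y w /in_dalethP/ge3 x3 /in_dalethP dw xyw; apply/in_dalethP.
  by apply: (down w) => //; lia.
- exact: daleth_in_R.
- move=> _ [n [Dn Dsn n4]].
  have [_ [[l [ml szl]] _]] := (n4, Dn).
  have [s ms szs] := long _ ml.
  have R2 : in_R H 2 by apply: (R2_long s) => //; lia.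
  have [es [ns [szn n2 en ind]]] := Dstar_indep Dsn.
  (* Each k - 1 is at most twice the integer part of k/2, so the element [d0] exceeds n/2. *)
  have half_bound : (\sum_(k <- ns) (k - 1) <= 2 * sumn (map half ns))%N.
    elim: (ns) n2 => [|k ks IH]; rewrite ?big_nil ?big_cons //= => /andP[k2 /IH].
    by lia.
  have d0 : zs_daleth (1 + sumn (map half ns)).
    apply: (zs_daleth_indep secK szn n2); last by lia.
    by move=> cs szc _; apply: ind.
  (* The maximum M exists because lengths in question are at most D(G); being at least the element
     [d0], it serves as catenary bound. *)
  have [M [dM maxM]] : exists M, zs_daleth M /\ forall m, zs_daleth m -> (m <= M)%N.
    have ex : exists m, `[< zs_daleth m >] by exists (1 + sumn (map half ns))%N; apply/asboolP.
    have ub m : `[< zs_daleth m >] -> (m <= n)%N.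
      move/asboolP; apply: zs_daleth_le => t; exact: dav.
    by case: (ex_maxnP ex ub) => M /asboolP dM hM; exists M; split=> // m dm; apply/hM/asboolP.
  have cM : cat_le H M.
    apply: (cat_le_bound (D := n)) => //.
    + by move=> t; apply: dav.
    + by have := maxM _ d0; lia.
    + by have := ge3 _ dM; lia.
  move=> d; have cat_daleth : (2 <= d)%N -> le_cat H d -> in_daleth H d \/ d = 2%N.
    move=> d2 /(_ _ cM) dM'; have [|d3] := leqP d 2; first by right; lia.
    by left; apply/in_dalethP; apply: (down M) => //; lia.
  have daleth_R : in_daleth H d \/ d = 2%N -> in_R H d.
    by case=> [/daleth_in_R|->].
  have R_daleth : in_R H d -> in_daleth H d \/ d = 2%N.
    by move=> Rd; apply: cat_daleth; [case: Rd | exact: in_R_le_cat].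
  split; [by split | split; split].
  + move/R_daleth => [/daleth_Delta[dd d2]|->]; last by right.
    by left; exists (d - 2)%N; split=> //; lia.
  + move=> [[delta [dd ed]]|->] //; apply: daleth_R; apply: cat_daleth; first by lia.
    by rewrite ed; apply: Delta_le_cat.
  + by move=> Rd; split; [case: Rd | exact: in_R_le_cat].
  + by move=> [d2 cd]; apply: daleth_R; apply: cat_daleth.
- split; [|split].
  + move=> [l [_ szl lG]] d; apply: trivial_not_in_R => g.
    case: l szl lG => [|x []] // _ lG.
    by move: (lG g) (lG 0); rewrite !inE => /eqP-> /eqP->.
  + move=> [l [ul szl lG]].
    have le2 s : minzs s -> (size s <= 2)%N by rewrite -szl; apply: size_minzs_card.
    have c2 : cat_le H 2.
      apply: (cat_le_bound (D := 2)) => // m dm.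
      exact: (zs_daleth_le le2 dm).
    have [g [g0 Gg]] : exists g : G, g <> 0 /\ forall h : G, h = 0 \/ h = g.
      case: l ul szl lG {le2} => [|x [|y []]] //= /andP[+ _] _ lG; rewrite inE => /eqP xy.
      have := lG 0; rewrite !inE => /orP[]/eqP x0.
      * exists y; split=> [y0|h]; first by apply: xy; rewrite -x0 y0.
        by have := lG h; rewrite !inE -x0 => /orP[]/eqP; [left|right].
      * exists x; split=> [x0'|h]; first by apply: xy; rewrite -x0 x0'.
        by have := lG h; rewrite !inE -x0 => /orP[]/eqP; [right|left].
    have [p [q [pq pg qg]]] := order2_two_primes g0 Gg.
    move=> d; split=> [Rd|->].
      by have := in_R_le_cat Rd c2; case: Rd; lia.
    apply: in_R2_bifactored; apply: (bifactored_two_primes secK pq); first by rewrite pg qg.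
    by rewrite pg.
  + move=> infG.
    have inf m : (3 <= m)%N -> zs_daleth m.
      (* A family of m elements with all n_i = 2 gives the element m + 1, from which m is reached
         downwards. *)
      move=> m3; have [es [sz ind]] := infinite_indep m infG.
      have hs : sumn (map half (nseq m 2)) = m by rewrite map_nseq sumn_nseq mul1n.
      have d1 : zs_daleth (1 + sumn (map half (nseq m 2))).
        apply: (zs_daleth_indep secK _ _ ind); first by rewrite size_nseq sz.
          by apply/allP => k; rewrite mem_nseq => /andP[_ /eqP->].
        by rewrite hs; lia.
      by apply: down d1 _; rewrite hs; lia.
    move=> d; split=> [[]//|d2].
    have [d3|d3] := leqP 3 d; first by apply/daleth_in_R/in_dalethP/inf.
    have -> : d = 2%N by lia.
    (* If all atoms had at most three terms, [zs_daleth_le] would contradict the membership of 4. *)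
    have [[s [ms s4]]|nex] := pselect (exists s, minzs s /\ (4 <= size s)%N).
      exact: R2_long ms s4.
    have le3 s : minzs s -> (size s <= 3)%N.
      by move=> ms; rewrite leqNgt; apply/negP => s4; apply: nex; exists s.
    by have := zs_daleth_le le3 (inf 4 isT).
- move=> D3 uniqp d.
  have [[l [ml szl]] _] := D3.
  have [s ms szs] := long _ ml.
  have le3 (t : seq P) : minzs t -> (size t <= 3)%N by apply: dav.
  have dal3 : in_daleth H 3 by apply/in_dalethP; apply: (daleth3 s) => //; lia.
  have dal_le m : zs_daleth m -> (m <= 3)%N by apply: zs_daleth_le.
  have c3 : cat_le H 3 by apply: (cat_le_bound (D := 3)).
  have nR2 : ~ in_R H 2.
    apply: not_in_R2 => // p q pq p0; have [x [_ ux]] := uniqp _ p0.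
    by rewrite -(ux p erefl) -(ux q (esym pq)).
  split; split=> [h|->] //.
  + have := in_R_le_cat h c3; have [d2 _] := h => d3.
    have : d <> 2%N by move=> e; apply: nR2; rewrite -e.
    by lia.
  + exact: daleth_in_R.
  + by move/in_dalethP: h => h; have := ge3 _ h; have := dal_le _ h; lia.
- move=> h.
  have [s ms s3] : exists2 s, minzs s & (3 <= size s)%N.
    case: h => [[[[l [ml szl]] _] _]|[l [ml szl]]];
      have [s ms szs] := long _ ml; exists s => //; lia.
  split; split; [|by move=> d []| |by move=> d /in_dalethP/ge3].
    case: h => [[_ [g [g0 [p [q [pq pg qg]]]]]]|[l [ml szl]]].
      apply: in_R2_bifactored; apply: (bifactored_two_primes secK pq); first by rewrite pg qg.
      by rewrite pg.
    by have [t mt szt] := long _ ml; apply: (R2_long t) => //; lia.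
  by apply/in_dalethP; apply: daleth3 ms s3.
Qed.

End Transfer.

Unset Implicit Arguments.

Theorem theorem1p1 (H : cmonoid) (P : Type) (phi : H -> list P)
    (G : zmodType) (cls : P -> G)
    (hK : Krull_with_class_group phi cls)
    (hprime : forall g : G, exists p, cls p = g) :
  (* daleth^*(H) is an interval *)
  (forall x y w, in_daleth H x -> in_daleth H w -> x <= y <= w ->
     in_daleth H y) /\
  (* daleth^*(H) \subset R(H) *)
  (forall m, in_daleth H m -> in_R H m) /\
  (* G finite and D(G) = D^*(G) >= 4 *)
  (grp_finite G ->
   (exists n, [/\ Davenport_eq G n, Dstar_eq G n & 4 <= n]) ->
   forall d,
     (in_R H d <-> in_daleth H d \/ d = 2) /\
     (in_R H d <-> (exists delta, in_Delta H delta /\ d = 2 + delta) \/ d = 2) /\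
     (in_R H d <-> 2 <= d /\ le_cat H d)) /\
  (* (1) *)
  ((grp_card G 1 -> forall d, ~ in_R H d) /\
   (grp_card G 2 -> forall d, in_R H d <-> d = 2) /\
   (~ grp_finite G -> forall d, in_R H d <-> 2 <= d)) /\
  (* (2) *)
  (Davenport_eq G 3 ->
   (forall g : G, g <> 0%R -> exists! p, cls p = g) ->
   forall d, (in_R H d <-> d = 3) /\ (in_daleth H d <-> d = 3)) /\
  (* (3) *)
  ((Davenport_eq G 3 /\
      (exists g : G, g <> 0%R /\ exists p q, [/\ p <> q, cls p = g & cls q = g])
    \/ Davenport_ge G 4) ->
   (in_R H 2 /\ forall d, in_R H d -> 2 <= d) /\
   (in_daleth H 3 /\ forall d, in_daleth H d -> 3 <= d)).
Proof.
(* Classical logic equips an arbitrary [P] with decidable equality. *)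
exact: (@theorem_eqType H {classic P} phi G cls hK hprime).
Qed.
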